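(* Let $\mathcal H$ be a finite-dimensional Hilbert space of dimension $N$. For every derived operator mean $M\in\mathfrak M^+$, $${\det}^{1/N}M(\mu)\ge M(({\det}^{1/N})_*\mu),\qquad\mu\in\mathcal P^\infty(\mathbb P(\mathcal H)),$$ where $({\det}^{1/N})_*\mu$ is the push-forward of $\mu$ by $A\in\mathbb P(\mathcal H)\mapsto(\det A)^{1/N}\in(0,\infty)$. The reversed inequality holds if $M\in\mathfrak M^-$.
   Context: For a Hilbert space $\mathcal H$, $\mathbb P=\mathbb P(\mathcal H)$ is the set of positive invertible bounded operators with the operator norm topology, $A\le B$ means $B-A$ is positive semidefinite. $\mathcal P^\infty(\mathbb P)$ is the set of Borel probability measures $\mu$ on $\mathbb P$ with $\mu(\mathrm{supp}(\mu))=1$ whose support is contained in $\{A:\varepsilon I\le A\le\varepsilon^{-1}I\}$ for some $\varepsilon\in(0,1)$. A two-variable operator mean $\sigma$ in the Kubo-Ando sense is given on $\mathbb P\times\mathbb P$ by $A\sigma B=A^{1/2}f_\sigma(A^{-1/2}BA^{-1/2})A^{1/2}$, where the representing function $f_\sigma:(0,\infty)\to(0,\infty)$ is operator monotone (on operators on arbitrary Hilbert spaces) with $f_\sigma(1)=1$; $\mathfrak l$ is the left trivial mean $X\,\mathfrak l\,Y=X$. $\sigma$ is g.c.v. (geometrically convex) if $f_\sigma(\sqrt{xy})\le\sqrt{f_\sigma(x)f_\sigma(y)}$ for all $x,y>0$, and g.c.c. (geometrically concave) if $f_\sigma(\sqrt{xy})\ge\sqrt{f_\sigma(x)f_\sigma(y)}$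 for all $x,y>0$. For $X\in\mathbb P$, $X\sigma\mu$ is the push-forward of $\mu$ by $A\mapsto X\sigma A$. Basic means on $\mathcal P^\infty(\mathbb P)$: arithmetic mean $\mathcal A(\mu)=\int A\,d\mu(A)$; harmonic mean $\mathrm{Har}(\mu)=[\int A^{-1}\,d\mu(A)]^{-1}$; Karcher mean $G(\mu)$, the unique $X\in\mathbb P$ with $\int_{\mathbb P}\log(X^{-1/2}AX^{-1/2})\,d\mu(A)=0$. Procedures producing new means from given ones: (A) Deformation: from $M$ and a two-variable operator mean $\sigma\ne\mathfrak l$, $M_\sigma(\mu)$ is the unique solution $X\in\mathbb P$ of $X=M(X\sigma\mu)$ (which exists). (B) Composition: from $M_0,M_1,\dots,M_n$ and a weight (probability vector) $(w_1,\dots,w_n)$, $n\in\mathbb N$, form $\mu\mapsto M_0\bigl(\sum_{j=1}^nw_j\delta_{M_j(\mu)}\bigr)$. $\mathfrak M^+$ (resp. $\mathfrak M^-$) is the class of means obtained by starting from $\mathcal A,G$ (resp. $\mathrm{Har},G$) and applying finitely many times procedure (A) with $\sigma$ restricted to g.c.v. (resp. g.c.c.) means and procedure (B). The same symbol $M$ denotes the mean obtained by the same construction over every Hilbert space; on the right-hand side $M$ is the corresponding mean for the one-dimensional Hilbert space, where $\mathbb P=(0,\infty)$. *)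

(* Defs.v *)
From HB Require Import structures.
From mathcomp Require Import all_boot all_order all_algebra spectral.
From mathcomp Require Import sesquilinear complex.
From mathcomp Require Import all_classical all_reals all_analysis.

Set Implicit Arguments.
Unset Strict Implicit.
Unset Printing Implicit Defensive.

Import Order.TTheory GRing.Theory Num.Theory.

Local Open Scope classical_set_scope.
Local Open Scope ring_scope.
Local Open Scope complex_scope.
Local Open Scope sesquilinear_scope.

(* A complex Hilbert space is a pair (H, dot) with [hcomplete dot]; nothing
   bounds its dimension. *)
Section Hilbert.
Variables (R : realType) (H : lmodType R[i]) (dot : {dot H for Num.conj}).
Implicit Types A B S : {linear H -> H}.

Definition hnorm (x : H) : R := Num.sqrt (complex.Re (dot x x)).

Definition hcomplete : Prop := forall u : nat -> H,
  (forall e : R, 0 < e -> exists n0, forall m n,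
     (n0 <= m)%N -> (n0 <= n)%N -> hnorm (u m - u n) < e) ->
  exists l, forall e : R, 0 < e -> exists n0, forall n,
     (n0 <= n)%N -> hnorm (u n - l) < e.

Definition hbounded A : Prop :=
  exists c : R, forall x, hnorm (A x) <= c * hnorm x.

(* [0 <= z] in R[i] says that z is real and nonnegative. *)
Definition hle A B : Prop := forall x, 0 <= dot (B x - A x) x.

Definition spectrum A : set R[i] := [set z | ~ exists S, [/\ hbounded S,
  forall x, S (A x - z *: x) = x & forall x, A (S x) - z *: S x = x]].

Definition hpos A : Prop :=
  [/\ hbounded A, forall x, 0 <= dot (A x) x & ~ spectrum A 0].

Definition poly_op (p : {poly R}) A (x : H) : H :=
  \sum_(k < size p) (p`_k)%:C *: iter k A x.

(* FA = f(A) in the continuous functional calculus of the self-adjoint A: FA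
   is the norm limit of p(A) for real polynomials p that converge to f
   uniformly on the spectrum of A. *)
Definition fcalc (f : R -> R) A FA : Prop := forall e : R, 0 < e ->
  exists p : {poly R},
    (forall t : R, spectrum A t%:C -> `|p.[t] - f t| <= e) /\
    (forall x, hnorm (poly_op p A x - FA x) <= e * hnorm x).

End Hilbert.

Definition operator_monotone (R : realType) (f : R -> R) : Prop :=
  forall (H : lmodType R[i]) (dot : {dot H for Num.conj}), hcomplete dot ->
  forall A B FA FB : {linear H -> H}, hpos dot A -> hpos dot B ->
    fcalc dot f A FA -> fcalc dot f B FB -> hle dot A B -> hle dot FA FB.

(* The Hilbert space of dimension N is 'rV[R[i]]_N with the dot product
   [dotmx]; a matrix A acts on it by x |-> x *m A. *)
Section Matrices.
Variables (R : realType) (N : nat).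
Implicit Types A B : 'M[R[i]]_N.

Definition psdmx A : bool :=
  (A \is hermsymmx) && `[< forall x : 'rV_N, 0 <= dotmx (x *m A) x >].

Definition opnorm A : R :=
  sup [set hnorm (@dotmx _ N) (x *m A) | x in
       [set x : 'rV_N | hnorm (@dotmx _ N) x <= 1]].

(* f(A) for a self-adjoint A, by the spectral theorem. *)
Definition mxfun (f : R -> R) A : 'M[R[i]]_N :=
  invmx (spectralmx A)
  *m diag_mx (map_mx (fun z => (f (complex.Re z))%:C) (spectral_diag A))
  *m spectralmx A.

Definition posmxb A : bool := psdmx A && (A \in unitmx).

Record posop := Posop { posmx :> 'M[R[i]]_N; posmxP : posmxb posmx }.

HB.instance Definition _ := [isSub for posmx].
HB.instance Definition _ := [Choice of posop by <:].

End Matrices.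

Section PosFacts.
Variables (R : realType).

Lemma dotmx_conj N (A S : 'M[R[i]]_N) (x : 'rV_N) : S \is hermsymmx ->
  dotmx (x *m (S *m A *m S)) x = dotmx (x *m S *m A) (x *m S).
Proof.
move=> /is_hermitianmxP; rewrite expr0 scale1r => hS.
rewrite !dotmxE; congr (fun_of_matrix _ 0 0).
by rewrite trmx_mul map_mxM /= -hS !mulmxA.
Qed.

Lemma hermsym_conj N (A S : 'M[R[i]]_N) : S \is hermsymmx ->
  A \is hermsymmx -> S *m A *m S \is hermsymmx.
Proof.
move=> /is_hermitianmxP; rewrite expr0 scale1r => hS.
move=> /is_hermitianmxP; rewrite expr0 scale1r => hA.
apply/is_hermitianmxP; rewrite expr0 scale1r.
by rewrite !trmx_mul !map_mxM /= -hS -hA mulmxA.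
Qed.

Lemma posmx_conj N (A S : 'M[R[i]]_N) : posmxb S -> posmxb A ->
  posmxb (S *m A *m S).
Proof.
move=> /andP[/andP[hS _] uS] /andP[/andP[hA /asboolP pA] uA].
apply/andP; split; last by rewrite !unitmx_mul uS uA.
apply/andP; split; first exact: hermsym_conj.
by apply/asboolP => x; rewrite dotmx_conj.
Qed.

Lemma posmx_inv N (A : 'M[R[i]]_N) : posmxb A -> posmxb (invmx A).
Proof.
move=> /andP[/andP[hA /asboolP pA] uA].
have hA' : invmx A \is hermsymmx.
  move/is_hermitianmxP: hA; rewrite expr0 scale1r => hA.
  apply/is_hermitianmxP; rewrite expr0 scale1r.
  by rewrite trmx_inv map_invmx -hA.
apply/andP; split; last by rewrite unitmx_inv.
apply/andP; split=> //; apply/asboolP => x.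
have -> : invmx A = invmx A *m A *m invmx A by rewrite mulVmx// mul1mx.
by rewrite dotmx_conj.
Qed.

Lemma posmx_diag N (U : 'M[R[i]]_N) (d : 'rV[R[i]]_N) : U \is unitarymx ->
  (forall i, 0 < d 0 i) -> posmxb (invmx U *m diag_mx d *m U).
Proof.
move=> uU d_gt0; set D := diag_mx _.
have UU : U \in unitmx by exact: unitarymx_unit.
have DD : D \in unitmx.
  rewrite unitmxE det_diag unitfE; apply/prodf_neq0 => i _.
  by rewrite gt_eqF.
have hD : D ^t Num.conj = D.
  rewrite tr_diag_mx map_diag_mx; congr diag_mx.
  by apply/rowP => i; rewrite mxE; apply/CrealP/gtr0_real.
apply/andP; split; last by rewrite !unitmx_mul unitmx_inv UU DD.
rewrite invmx_unitary//; apply/andP; split.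
  apply/is_hermitianmxP; rewrite expr0 scale1r.
  by rewrite !trmx_mul !map_mxM /= hD trmxCK mulmxA.
apply/asboolP => x; rewrite dotmxE.
set y := x *m U ^t Num.conj.
have -> : x *m (U ^t Num.conj *m D *m U) *m x ^t Num.conj
          = y *m D *m y ^t Num.conj.
  by rewrite /y trmx_mul map_mxM /= trmxCK !mulmxA.
rewrite mxE; apply: sumr_ge0 => i _.
rewrite mul_mx_diag !mxE mulrAC; apply: mulr_ge0; last exact/ltW.
exact: mul_conjC_ge0.
Qed.

Lemma posmx_spectral_gt0 N (A : 'M[R[i]]_N) : posmxb A ->
  A = invmx (spectralmx A) *m diag_mx (spectral_diag A) *m spectralmx A /\
  forall i, 0 < spectral_diag A 0 i.
Proof.
move=> /andP[/andP[hA /asboolP pA] uA].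
have /orthomx_spectralP AE := hermitian_normalmx hA.
split=> // i; set U := spectralmx A in AE *; set d := spectral_diag A in AE *.
have uU : U \is unitarymx := spectral_unitarymx A.
have UU : U \in unitmx := spectral_unit A.
have di : d 0 i = dotmx ('e_i *m U *m A) ('e_i *m U).
  rewrite dotmxE trmx_mul map_mxM /= -(invmx_unitary uU) AE.
  rewrite !mulmxA mulmxK// mulmxK//.
  rewrite -rowE trmx_delta map_delta_mx -colE.
  by rewrite !mxE eqxx mulr1n.
have di0 : d 0 i != 0.
  move: uA; rewrite AE !unitmx_mul unitmx_inv UU andbT /= unitmxE det_diag.
  by rewrite unitfE => /prodf_neq0/(_ i isT).
by rewrite lt_def di0 di pA.
Qed.

Lemma posmx_fun N (f : R -> R) (A : 'M[R[i]]_N) :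
  (forall t, 0 < t -> 0 < f t) -> posmxb A -> posmxb (mxfun f A).
Proof.
move=> f_gt0 /posmx_spectral_gt0[_ d_gt0].
apply: posmx_diag => [|i]; first exact: spectral_unitarymx.
rewrite mxE ltcR; apply: f_gt0.
by have := d_gt0 i; rewrite ltcE => /andP[].
Qed.

Lemma posmx_det_gt0 N (A : 'M[R[i]]_N) : posmxb A -> 0 < \det A.
Proof.
move=> /posmx_spectral_gt0[AE d_gt0]; rewrite AE.
rewrite !det_mulmx mulrAC -det_mulmx mulVmx ?spectral_unit// det1 mul1r.
by rewrite det_diag; apply: prodr_gt0.
Qed.

Lemma posmx_scalar N (x : R) : 0 < x -> posmxb (x%:C%:M : 'M[R[i]]_N).
Proof.
move=> x_gt0; have /(posmx_diag (d := const_mx x%:C)) : (1%:M : 'M[R[i]]_N) \is unitarymx.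
  by apply/unitarymxP; rewrite trmx1 map_mx1 mulmx1.
rewrite diag_const_mx mulmx1 invmx1 mul1mx; apply => i.
by rewrite mxE ltcR.
Qed.

End PosFacts.

Section Borel.
Variables (R : realType) (N : nat).

Definition posop_scalar (x : R) (x_gt0 : 0 < x) : posop R N :=
  Posop (posmx_scalar N x_gt0).

HB.instance Definition _ :=
  isPointed.Build (posop R N) (posop_scalar ltr01).

Definition posop_open (U : set (posop R N)) : Prop :=
  forall A, U A -> exists2 e : R, 0 < e &
    forall B : posop R N, opnorm (posmx B - posmx A) < e -> U B.

HB.instance Definition _ :=
  @isMeasurable.Build (sigma_display posop_open) (posop R N)
    <<s posop_open >> (@sigma_algebra0 _ setT posop_open)
    (@sigma_algebraC _ posop_open) (@sigma_algebra_bigcup _ setT posop_open).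

Definition supp (mu : set (posop R N) -> \bar R) : set (posop R N) :=
  [set A | forall U, posop_open U -> U A -> (0 < mu U)%E].

Definition Pinfty (mu : set (posop R N) -> \bar R) : Prop :=
  [/\ exists P : probability (posop R N) R, mu = P,
      mu (supp mu) = 1%E &
      exists e : R, [/\ 0 < e, e < 1 & forall A, supp mu A ->
        psdmx (posmx A - e%:C%:M) /\ psdmx (e^-1%:C%:M - posmx A)]].

Definition mxintegral (mu : set (posop R N) -> \bar R)
    (F : posop R N -> 'M[R[i]]_N) : 'M[R[i]]_N :=
  \matrix_(i, j)
    (fine (\int[mu]_A (complex.Re (F A i j))%:E)%E
     +i* fine (\int[mu]_A (complex.Im (F A i j))%:E)%E).

End Borel.

(* A two-variable operator mean, given by its representing function; only the
   values of the function on the positive half-line matter. *)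
Record opmean (R : realType) := OpMean {
  repf :> R -> R;
  repf_gt0 : forall x, 0 < x -> 0 < repf x;
  repf_monotone : operator_monotone repf;
  repf1 : repf 1 = 1 }.

Definition gcv (R : realType) (sigma : opmean R) : Prop :=
  forall x y : R, 0 < x -> 0 < y ->
    sigma (Num.sqrt (x * y)) <= Num.sqrt (sigma x * sigma y).

Definition gcc (R : realType) (sigma : opmean R) : Prop :=
  forall x y : R, 0 < x -> 0 < y ->
    Num.sqrt (sigma x * sigma y) <= sigma (Num.sqrt (x * y)).

Definition mxsqrt (R : realType) N (A : 'M[R[i]]_N) := mxfun Num.sqrt A.

Definition mxlog (R : realType) N (A : 'M[R[i]]_N) := mxfun (@ln R) A.

Definition opmean_mx (R : realType) (sigma : opmean R) N (A B : posop R N) :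
    'M[R[i]]_N :=
  mxsqrt A *m mxfun sigma (invmx (mxsqrt A) *m B *m invmx (mxsqrt A))
  *m mxsqrt A.

Lemma opmean_mxP (R : realType) (sigma : opmean R) N (A B : posop R N) :
  posmxb (opmean_mx sigma A B).
Proof.
have sqrtA : posmxb (mxsqrt A).
  by apply: posmx_fun (posmxP A) => t; rewrite sqrtr_gt0.
apply: posmx_conj => //; apply: posmx_fun (@repf_gt0 _ _) _.
by apply: posmx_conj (posmxP B); apply: posmx_inv.
Qed.

Definition opmean_app (R : realType) (sigma : opmean R) N (A B : posop R N) :
  posop R N := Posop (opmean_mxP sigma A B).

Definition left_trivial (R : realType) (sigma : opmean R) : Prop :=
  forall N (A B : posop R N), opmean_app sigma A B = A.

(* The same mean over the Hilbert spaces of all finite dimensions. The domain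
   is all set functions, so that pushforwards need no measurability proof; only
   the values on [Pinfty] are constrained below. *)
Definition mean (R : realType) : Type :=
  forall N, (set (posop R N) -> \bar R) -> posop R N.

Section Means.
Variable R : realType.
Implicit Types M : mean R.

Definition is_arithmetic M : Prop := forall N mu, @Pinfty R N mu ->
  M N mu = mxintegral mu (fun A => A) :> 'M[R[i]]_N.

Definition is_harmonic M : Prop := forall N mu, @Pinfty R N mu ->
  M N mu = invmx (mxintegral mu (fun A => invmx A)) :> 'M[R[i]]_N.

Definition is_karcher M : Prop := forall N mu, @Pinfty R N mu ->
  unique (fun X : posop R N => mxintegral mu (fun A =>
    mxlog (invmx (mxsqrt X) *m A *m invmx (mxsqrt X))) = 0) (M N mu).

Definition is_deformation M (sigma : opmean R) (M' : mean R) : Prop :=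
  forall N mu, @Pinfty R N mu ->
  unique (fun X => X = M N (pushforward mu (opmean_app sigma X))) (M' N mu).

Definition is_composition (n : nat) (w : 'I_n -> R) (M0 : mean R)
    (Ms : 'I_n -> mean R) (M' : mean R) : Prop :=
  forall N mu, @Pinfty R N mu ->
  M' N mu = M0 N (fun U => \sum_(j < n) (w j)%:E * \d_(Ms j N mu) U)%E.

Inductive derived (base : mean R -> Prop) (adm : opmean R -> Prop) :
    mean R -> Prop :=
| derived_base M : base M -> derived base adm M
| derived_deformation M sigma M' :
    derived base adm M -> adm sigma -> ~ left_trivial sigma ->
    is_deformation M sigma M' -> derived base adm M'
| derived_composition n (w : 'I_n -> R) M0 (Ms : 'I_n -> mean R) M' :
    (forall j, 0 <= w j) -> \sum_j w j = 1 ->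
    derived base adm M0 -> (forall j, derived base adm (Ms j)) ->
    is_composition w M0 Ms M' -> derived base adm M'.

Definition derived_plus : mean R -> Prop :=
  derived (fun M => is_arithmetic M \/ is_karcher M) (@gcv R).

Definition derived_minus : mean R -> Prop :=
  derived (fun M => is_harmonic M \/ is_karcher M) (@gcc R).

End Means.

Section DetRoot.
Variables (R : realType) (N : nat).

Definition detroot (A : posop R N) : R :=
  complex.Re (\det A) `^ (N%:R^-1).

Lemma detroot_gt0 (A : posop R N) : 0 < detroot A.
Proof.
apply: powR_gt0; have := posmx_det_gt0 (posmxP A).
by rewrite ltcE => /andP[].
Qed.

(* In dimension one, P(H) is identified with the positive half-line. *)
Definition detroot_op (A : posop R N) : posop R 1 :=
  posop_scalar 1 (detroot_gt0 A).

Definition posop1_val (A : posop R 1) : R := complex.Re (A 0 0).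

End DetRoot.

(* Main.v *)
(** In dimension one every derived mean is homogeneous and monotone, by induction
    on its construction. Hence y |-> M(y sigma nu) / y is nonincreasing, and since
    M_sigma(nu) is the only solution of y = M(y sigma nu), any y with
    y >= M(y sigma nu) satisfies y >= M_sigma(nu), and dually; no convergence of
    an iteration is needed.

    For the inequality itself, write d(A) = det(A)^(1/N). The arithmetic mean X
    of mu satisfies d(A) <= d(X) tr(X^-1 A) / N by AM-GM, which integrates to
    int d(A) <= d(X); the harmonic mean is the same inequality for inverses, and
    the Karcher equation becomes the scalar one after taking traces. Geometric
    convexity of f_sigma gives d(X) sigma d(A) <= d(X sigma A), so the
    deformation X = M(X sigma mu) satisfies d(X) >= M(d(X) sigma d_* mu), and the
    first paragraph concludes. Geometric concavity gives the reverse inequality. *)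

Require Import Defs.
From HB Require Import structures.
From mathcomp Require Import all_boot all_order all_algebra spectral.
From mathcomp Require Import sesquilinear complex.
From mathcomp Require Import all_classical all_reals all_analysis.
From mathcomp Require Import measurable_realfun ring lra.

Set Implicit Arguments.
Unset Strict Implicit.
Unset Printing Implicit Defensive.

Import Order.TTheory GRing.Theory Num.Theory.
Import numFieldNormedType.Exports.

Local Open Scope classical_set_scope.
Local Open Scope ring_scope.
Local Open Scope complex_scope.
Local Open Scope sesquilinear_scope.

(** Every step of the induction must stay inside [Pinfty], so each map along which a measure is
    pushed forward has to be continuous and to keep order intervals bounded. For A -> X sigma A this
    asks for continuity of f_sigma. Operator monotonicity, read on the one-dimensional Hilbert
    space, makes f_sigma nondecreasing; then u -> ln f_sigma(e^u) is nondecreasing and midconvex (in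
    the g.c.c. case after reversing the signs of argument and value), hence continuous. Continuity
    of A -> f(A) comes from a Frobenius-norm estimate across the two eigenbases. Monotonicity of a
    scalar mean is phrased by a coupling: two positive functions on one probability space, compared
    pointwise. This fits both uses: d(X) sigma d(A) and d(X sigma A) are functions of the same
    random A, and two finite combinations with common weights are functions of the same random
    index. In dimension N the deformation step uses the fixed-point equation; uniqueness is invoked
    in dimension one, where the total order turns it into a comparison principle. *)

(** * Operator monotonicity on the one-dimensional Hilbert space *)

Section ScalarOperators.
Variable R : realType.
Local Notation dot1 := (@dotmx R[i] 1).

Lemma dotmx1E (x : 'rV[R[i]]_1) : dot1 x x =
  (complex.Re (x 0 0) ^+ 2 + complex.Im (x 0 0) ^+ 2)%:C.
Proof.
rewrite dotmxE mxE big_ord1 !mxE; case: (x 0 0) => a b.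
by apply/eqP; rewrite eq_complex /=; apply/andP; split; apply/eqP; ring.
Qed.

Lemma hnorm1E (x : 'rV[R[i]]_1) : hnorm dot1 x =
  Num.sqrt (complex.Re (x 0 0) ^+ 2 + complex.Im (x 0 0) ^+ 2).
Proof. by rewrite /hnorm /= dotmx1E. Qed.

Lemma hnorm1Z (c : R) (x : 'rV[R[i]]_1) :
  hnorm dot1 (c%:C *: x) = `|c| * hnorm dot1 x.
Proof.
rewrite !hnorm1E -sqrtr_sqr -sqrtrM ?sqr_ge0//; congr Num.sqrt.
by rewrite mxE; case: (x 0 0) => a b /=; ring.
Qed.

Lemma cauchy_seq_limit (u : nat -> R) :
  (forall e : R, 0 < e -> exists n0, forall m n,
     (n0 <= m)%N -> (n0 <= n)%N -> `|u m - u n| < e) ->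
  exists l, forall e : R, 0 < e -> exists n0, forall n,
     (n0 <= n)%N -> `|u n - l| < e.
Proof.
move=> cu; have /cauchy_cvg/cvg_ex[l ul] : cauchy (u @ \oo).
  apply/cauchy_exP => e e0; have [n0 hn0] := cu e e0.
  by exists (u n0), n0 => // n /= n0n; exact: hn0.
exists l => e e0; move/cvgrPdist_lt : ul => /(_ e e0)[n0 _ hn0].
by exists n0 => n n0n; rewrite distrC; exact: hn0.
Qed.

Lemma hcomplete1 : hcomplete dot1.
Proof.
move=> u cu.
have ReE (x : 'rV[R[i]]_1) : `|complex.Re (x 0 0)| <= hnorm dot1 x.
  by rewrite hnorm1E -sqrtr_sqr ler_wsqrtr// lerDl sqr_ge0.
have ImE (x : 'rV[R[i]]_1) : `|complex.Im (x 0 0)| <= hnorm dot1 x.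
  by rewrite hnorm1E -sqrtr_sqr ler_wsqrtr// lerDr sqr_ge0.
have [e e0|a ha] := @cauchy_seq_limit (fun n => complex.Re (u n 0 0)).
  have [n0 hn0] := cu e e0; exists n0 => m n m0 n1.
  by apply: le_lt_trans (hn0 m n m0 n1); rewrite (le_trans _ (ReE _))// !mxE raddfB.
have [e e0|b hb] := @cauchy_seq_limit (fun n => complex.Im (u n 0 0)).
  have [n0 hn0] := cu e e0; exists n0 => m n m0 n1.
  by apply: le_lt_trans (hn0 m n m0 n1); rewrite (le_trans _ (ImE _))// !mxE raddfB.
exists (const_mx (a +i* b)) => e e0.
(* Real and imaginary parts within e/2 give a squared distance of at most e^2/2, which is below
   e^2. *)
have e2 : 0 < e / 2 by rewrite divr_gt0.
have [n0 hn0] := ha _ e2; have [n1 hn1] := hb _ e2.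
exists (maxn n0 n1) => n; rewrite geq_max => /andP[/hn0 + /hn1].
rewrite hnorm1E !mxE; case: (u n 0 0) => c d /=.
move=> ca db.
have e_ge0 : 0 <= e by exact: ltW.
rewrite -(ger0_norm e_ge0) -sqrtr_sqr ltr_sqrt ?exprn_gt0//.
rewrite -(real_normK (num_real (c - a))) -(real_normK (num_real (d - b))).
have := normr_ge0 (c - a); have := normr_ge0 (d - b); nra.
Qed.

Lemma scale1_inverse (x t : R) : x != t ->
  exists S : {linear 'rV[R[i]]_1 -> 'rV[R[i]]_1}, [/\ hbounded dot1 S,
  forall y, S (x%:C *: y - t%:C *: y) = y &
  forall y, x%:C *: S y - t%:C *: S y = y].
Proof.
move=> xt; exists ( *:%R ((x - t)^-1)%:C).
have E (y : 'rV[R[i]]_1) : ((x - t)^-1)%:C *: (x%:C *: y - t%:C *: y) = y.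
  rewrite -scalerBl scalerA -rmorphB -rmorphM mulVf ?scale1r//.
  by rewrite subr_eq0.
split=> [|//|y].
- by exists `|(x - t)^-1| => z; rewrite hnorm1Z.
- by rewrite -scalerBl scalerA mulrC -scalerA scalerBl E.
Qed.

Lemma hpos_scale1 (x : R) : 0 < x -> hpos dot1 ( *:%R x%:C).
Proof.
move=> x0; split.
- by exists `|x| => y; rewrite hnorm1Z.
- move=> y; rewrite /= dotmxE -scalemxAl mxE -dotmxE.
  by rewrite mulr_ge0 ?dnorm_ge0// lecR ltW.
- by apply; apply: scale1_inverse; rewrite gt_eqF.
Qed.

(** The only real spectral value of multiplication by x is x itself, so the constant polynomial f(x)
    approximates f on the spectrum without error. Since f(x) is nonzero this polynomial has size 1,
    and [poly_op] reduces to a single term. *)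
Lemma fcalc_scale1 (f : R -> R) (x : R) : f x != 0 ->
  fcalc dot1 f ( *:%R x%:C) ( *:%R (f x)%:C).
Proof.
move=> fx0 e e0; exists (f x)%:P; split=> [t|y].
  have [->|xt] := eqVneq x t; first by rewrite hornerC subrr normr0 => _; exact: ltW.
  by case; exact: scale1_inverse.
rewrite /poly_op size_polyC fx0 /= big_ord1 coefC /= subrr.
have -> : hnorm dot1 0 = 0 by rewrite hnorm1E mxE /= expr0n addr0 sqrtr0.
by rewrite mulr_ge0 ?sqrtr_ge0 ?ltW.
Qed.

(** Operator monotonicity is tested on the multiplications by x and y on a one-dimensional space and
    evaluated at the vector 1. *)
Lemma repf_nondecreasing (sigma : opmean R) (x y : R) :
  0 < x -> x <= y -> sigma x <= sigma y.
Proof.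
move=> x0 xy; have y0 := lt_le_trans x0 xy.
have nz t : 0 < t -> sigma t != 0 by move=> /(repf_gt0 sigma); exact: lt0r_neq0.
have := repf_monotone hcomplete1 (hpos_scale1 x0) (hpos_scale1 y0)
  (fcalc_scale1 (nz x x0)) (fcalc_scale1 (nz y y0)).
have E (a b : R) : dot1 (b%:C *: const_mx 1 - a%:C *: const_mx 1) (const_mx 1)
    = (b - a)%:C.
  by rewrite -scalerBl dotmxE -scalemxAl mxE -dotmxE dotmx1E !mxE /=
     expr0n addr0 expr1n mulr1 rmorphB.
have xyle : hle dot1 ( *:%R x%:C) ( *:%R y%:C).
  move=> z; rewrite /= -scalerBl dotmxE -scalemxAl mxE -dotmxE -rmorphB.
  by rewrite mulr_ge0 ?dnorm_ge0// lecR subr_ge0.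
by move=> /(_ xyle (const_mx 1)); rewrite /= E lecR subr_ge0.
Qed.

End ScalarOperators.

(** * Midpoint convexity: Jensen's inequality and continuity *)

Section MidpointConvexity.
Variable R : realType.
Implicit Types g : R -> R.

Definition midconvex g := forall u v, g ((u + v) / 2) <= (g u + g v) / 2.

(** Each doubling applies midpoint convexity to the means of the two halves of the family. *)
Lemma midconvex_pow2 g k (x : nat -> R) : midconvex g ->
  (2 ^ k)%:R * g ((\sum_(i < 2 ^ k) x i) / (2 ^ k)%:R) <= \sum_(i < 2 ^ k) g (x i).
Proof.
move=> cg; elim: k x => [|k IHk] x.
  by rewrite expn0 !big_ord1 mul1r divr1.
set K := (2 ^ k)%N in IHk *.
have K0 : K%:R != 0 :> R by rewrite pnatr_eq0 -lt0n expn_gt0.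
have KK : (2 ^ k.+1 = K + K)%N by rewrite expnS mul2n addnn.
rewrite KK !big_split_ord /= natrD.
have := IHk x; have /= := IHk (fun i => x (K + i)%N).
set s1 := \sum_(i < K) x i; set s2 := \sum_(i < K) x (K + i)%N => h2 h1.
have := cg (s1 / K%:R) (s2 / K%:R).
have -> : (s1 / K%:R + s2 / K%:R) / 2 = (s1 + s2) / (K%:R + K%:R).
  by field; rewrite K0 andbT -mulr2n mulrn_eq0 (negbTE K0).
have : 0 < K%:R :> R by rewrite lt0r K0 ler0n.
by nra.
Qed.

(* Cauchy's forward-backward induction: pad the family with its mean until its
   size is a power of two. *)
Lemma midconvex_mean g n (x : 'I_n -> R) : midconvex g -> (0 < n)%N ->
  n%:R * g ((\sum_i x i) / n%:R) <= \sum_i g (x i).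
Proof.
move=> cg n0; set m := _ / _.
have nz : n%:R != 0 :> R by rewrite pnatr_eq0 -lt0n.
pose y k := if insub k is Some i then x i else m.
have yE (i : 'I_n) : y i = x i by rewrite /y valK.
have ym k : (n <= k)%N -> y k = m.
  by move=> nk; rewrite /y insubF// ltnNge nk.
have nK : (n <= 2 ^ n)%N by exact/ltnW/ltn_expl.
have := midconvex_pow2 n y cg.
have KE : (2 ^ n = n + (2 ^ n - n))%N by rewrite subnKC.
set d := (2 ^ n - n)%N in KE.
rewrite KE !big_split_ord /=.
under eq_bigr do rewrite yE.
under [X in _ <= X + _]eq_bigr do rewrite yE.
under [X in (_ + X) / _]eq_bigr do rewrite ym ?leq_addr//.
under [X in _ <= _ + X]eq_bigr do rewrite ym ?leq_addr//.
rewrite !sumr_const !card_ord.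
have -> : (\sum_i x i + m *+ d) / (n + d)%:R = m.
  rewrite -[\sum_i x i](divfK nz) -/m -[m *+ d]mulr_natr -mulrDr -natrD mulfK//.
  by rewrite pnatr_eq0 addn_eq0 -leqn0 leqNgt n0.
by rewrite natrD mulrDl -[g m *+ d]mulr_natl lerD2r.
Qed.

(** Repeated bisection bounds the increment of g over [t, t + 2^-n] by 2^-n times its increment over
    [t, t + 1]. Midpoint convexity at t - d and t + d bounds the left increment by the right one,
    and monotonicity covers the points in between. *)
Lemma nondecreasing_midconvex_continuous g : {homo g : x y / x <= y} ->
  midconvex g -> continuous g.
Proof.
move=> ng cg t.
have step n : g (t + 2^-1 ^+ n) - g t <= (g (t + 1) - g t) * 2^-1 ^+ n.
  elim: n => [|n IHn]; first by rewrite !expr0 mulr1.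
  have := cg t (t + 2^-1 ^+ n); rewrite exprS.
  have -> : (t + (t + 2^-1 ^+ n)) / 2 = t + 2^-1 * 2^-1 ^+ n by field.
  by lra.
apply/cvgrPdist_le => e e0.
have [n hn] : exists n : nat, (g (t + 1) - g t) * 2^-1 ^+ n <= e.
  have : ((g (t + 1) - g t) * 2^-1 ^+ n @[n --> \oo] --> (g (t + 1) - g t) * 0).
    by apply: cvgM; [exact: cvg_cst|apply: cvg_expr; rewrite ger0_norm; lra].
  rewrite mulr0 => /cvgrPdist_le/(_ e e0)[n _ /(_ n (leqnn n))] /=.
  by rewrite sub0r normrN => h; exists n; exact: le_trans (ler_norm _) h.
set d := 2^-1 ^+ n in hn.
have d0 : 0 < d by rewrite exprn_gt0// invr_gt0.
have hr := le_trans (step n) hn; rewrite -/d in hr.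
have hl : g t - g (t - d) <= e.
  have := cg (t - d) (t + d).
  have -> : (t - d + (t + d)) / 2 = t by field.
  by lra.
near=> s.
have : `|t - s| <= d by near: s; exact: cvgr_dist_le.
rewrite ler_distl => /andP[ts st]; rewrite ler_distl.
have h1 : g (t - d) <= g s by apply: ng; lra.
have h2 : g s <= g (t + d) by apply: ng; lra.
by apply/andP; split; lra.
Unshelve. all: by end_near.
Qed.

End MidpointConvexity.

(** * Geometric convexity in logarithmic coordinates *)

Section GeometricConvexity.
Variable R : realType.
Implicit Types sigma : opmean R.

Lemma expR_half (u v : R) : expR ((u + v) / 2) = Num.sqrt (expR u * expR v).
Proof.
rewrite -expRD -[LHS]ger0_norm ?expR_ge0// -sqrtr_sqr -expRM_natl.
by congr (Num.sqrt (expR _)); field.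
Qed.

Lemma ln_sqrtM (x y : R) : 0 < x -> 0 < y ->
  ln (Num.sqrt (x * y)) = (ln x + ln y) / 2.
Proof.
move=> x0 y0; rewrite -[in LHS](lnK x0) -[in LHS](lnK y0) -expR_half.
by rewrite expRK.
Qed.

Lemma gcv_midconvex sigma :
  gcv sigma -> midconvex (fun u => ln (sigma (expR u))).
Proof.
move=> gs u v; rewrite expR_half -ln_sqrtM ?repf_gt0 ?expR_gt0//.
rewrite ler_ln ?posrE ?sqrtr_gt0 ?mulr_gt0 ?repf_gt0 ?sqrtr_gt0 ?mulr_gt0 ?expR_gt0//.
by apply: gs; exact: expR_gt0.
Qed.

(** Both signs are reversed: the outer one turns concavity into convexity, the inner one keeps the
    function nondecreasing, as the continuity lemma requires. *)
Lemma gcc_midconvex sigma :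
  gcc sigma -> midconvex (fun u => - ln (sigma (expR (- u)))).
Proof.
move=> gs u v; rewrite -mulNr opprD expR_half -opprD mulNr lerN2.
rewrite -ln_sqrtM ?repf_gt0 ?expR_gt0//.
rewrite ler_ln ?posrE ?sqrtr_gt0 ?mulr_gt0 ?repf_gt0 ?sqrtr_gt0 ?mulr_gt0 ?expR_gt0//.
by apply: gs; exact: expR_gt0.
Qed.

Lemma ln_repf_homo sigma : {homo (fun u => ln (sigma (expR u))) : x y / x <= y}.
Proof.
move=> u v uv; rewrite ler_ln ?posrE ?repf_gt0 ?expR_gt0//.
by rewrite repf_nondecreasing ?expR_gt0 ?ler_expR.
Qed.

(** This continuity is what makes A -> X sigma A continuous, hence Borel. *)
Lemma repf_continuous sigma : gcv sigma \/ gcc sigma ->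
  forall t, 0 < t -> {for t, continuous sigma}.
Proof.
move=> gs t t0.
have cg : continuous (fun u => ln (sigma (expR u))).
  case: gs => [/gcv_midconvex|/gcc_midconvex] cs.
    exact: nondecreasing_midconvex_continuous (@ln_repf_homo sigma) cs.
  have {}cs : continuous (fun u => - ln (sigma (expR (- u)))).
    apply: nondecreasing_midconvex_continuous cs => u v uv.
    by rewrite lerN2 ln_repf_homo// lerN2.
  move=> u; have -> : (fun u => ln (sigma (expR u))) =
      -%R \o (fun u => - ln (sigma (expR (- u)))) \o -%R.
    by apply/funext => v /=; rewrite !opprK.
  apply: continuous_comp; first exact: oppr_continuous.
  by apply: continuous_comp; [exact: cs|exact: oppr_continuous].
(* [h] agrees with [sigma] only on the positive half-line, so continuity is transferred through a
   neighbourhood of t. *)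
pose h := expR \o ((fun u => ln (sigma (expR u))) \o @ln R).
have hE s : 0 < s -> h s = sigma s by move=> s0; rewrite /h /= !lnK ?posrE ?repf_gt0.
have : h x @[x --> t] --> h t.
  apply: continuous_comp; last exact: continuous_expR.
  by apply: continuous_comp; [exact: continuous_ln|exact: cg].
rewrite (hE t t0); apply: cvg_trans; apply: near_eq_cvg.
by near=> s; apply/hE; near: s; exact: lt_nbhsr.
Unshelve. all: by end_near.
Qed.

Lemma powR_prod_expR n (x : 'I_n -> R) : (forall i, 0 < x i) ->
  (\prod_i x i) `^ n%:R^-1 = expR ((\sum_i ln (x i)) / n%:R).
Proof.
move=> x0; rewrite /powR gt_eqF ?prodr_gt0//; congr expR.
rewrite mulrC; congr (_ * _).
(* Positivity of the partial products is carried along because [lnM] asks for it. *)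
suff [] : 0 < \prod_i x i /\ ln (\prod_i x i) = \sum_i ln (x i) by [].
elim/big_ind2: _ => [|a u b v [a0 <-] [b0 <-]|//]; first by rewrite ln1.
by rewrite mulr_gt0// lnM.
Qed.

(** Jensen's inequality for n equal weights at the logarithms. It will be applied to eigenvalues,
    whose product is a determinant. *)
Lemma gcv_geometric_mean sigma n (x : 'I_n -> R) : gcv sigma -> (0 < n)%N ->
  (forall i, 0 < x i) ->
  sigma ((\prod_i x i) `^ n%:R^-1) <= (\prod_i sigma (x i)) `^ n%:R^-1.
Proof.
move=> gs n0 x0; have sx0 i : 0 < sigma (x i) by exact: repf_gt0.
rewrite !powR_prod_expR//.
rewrite -[leLHS]lnK ?posrE ?repf_gt0 ?expR_gt0// ler_expR.
rewrite ler_pdivlMr ?ltr0n// mulrC.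
apply: le_trans (midconvex_mean _ (gcv_midconvex gs) n0) _.
by under eq_bigr do rewrite lnK ?posrE//.
Qed.

Lemma gcc_geometric_mean sigma n (x : 'I_n -> R) : gcc sigma -> (0 < n)%N ->
  (forall i, 0 < x i) ->
  (\prod_i sigma (x i)) `^ n%:R^-1 <= sigma ((\prod_i x i) `^ n%:R^-1).
Proof.
move=> gs n0 x0; have sx0 i : 0 < sigma (x i) by exact: repf_gt0.
rewrite !powR_prod_expR//.
rewrite -[leRHS]lnK ?posrE ?repf_gt0 ?expR_gt0// ler_expR.
rewrite ler_pdivrMr ?ltr0n// mulrC.
have := midconvex_mean (fun i => - ln (x i)) (gcc_midconvex gs) n0.
rewrite !sumrN mulNr opprK mulrN lerN2; apply: le_trans.
by under [leRHS]eq_bigr do rewrite opprK lnK ?posrE//.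
Qed.

End GeometricConvexity.

(** * The Frobenius norm and its unitary invariance *)

Section Frobenius.
Variable R : realType.
Local Notation C := R[i].

Definition nsq (z : C) : R := complex.Re z ^+ 2 + complex.Im z ^+ 2.

Lemma nsq_ge0 z : 0 <= nsq z.
Proof. by rewrite addr_ge0 ?sqr_ge0. Qed.

Lemma nsqE z : (nsq z)%:C = z * Num.conj z.
Proof.
by case: z => a b; apply/eqP; rewrite eq_complex /= /nsq /=; apply/andP;
  split; apply/eqP; ring.
Qed.

Lemma nsqM z w : nsq (z * w) = nsq z * nsq w.
Proof. by case: z w => [a b] [c d]; rewrite /nsq /=; ring. Qed.

Lemma nsqR (c : R) : nsq c%:C = c ^+ 2.
Proof. by rewrite /nsq /= expr0n addr0. Qed.

(** The square of the Frobenius norm; without the root it is a polynomial in the real and imaginary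
    parts of the entries. *)
Definition frob m n (A : 'M[C]_(m, n)) : R := \sum_i \sum_j nsq (A i j).

Lemma frob_ge0 m n (A : 'M[C]_(m, n)) : 0 <= frob A.
Proof. by do 2! apply: sumr_ge0 => ? _; exact: nsq_ge0. Qed.

Lemma nsq_le_frob m n (A : 'M[C]_(m, n)) i j : nsq (A i j) <= frob A.
Proof.
rewrite /frob (bigD1 i)//= (bigD1 j)//= -addrA lerDl addr_ge0//.
  by apply: sumr_ge0 => ? _; exact: nsq_ge0.
by do 2! apply: sumr_ge0 => ? _; exact: nsq_ge0.
Qed.

Lemma frobE m n (A : 'M[C]_(m, n)) : (frob A)%:C = \tr (A *m A ^t Num.conj).
Proof.
rewrite /frob rmorph_sum /mxtrace; apply: eq_bigr => i _.
by rewrite rmorph_sum mxE; apply: eq_bigr => j _; rewrite /= nsqE !mxE.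
Qed.

Lemma frob_unitaryl m n (U : 'M[C]_m) (A : 'M[C]_(m, n)) :
  U \is unitarymx -> frob (U *m A) = frob A.
Proof.
move=> uU; apply: complexI; rewrite !frobE trmx_mul map_mxM /= !mulmxA.
rewrite mxtrace_mulC !mulmxA -(invmx_unitary uU) mulVmx ?mul1mx//.
exact: unitarymx_unit.
Qed.

Lemma frob_unitaryr m n (A : 'M[C]_(m, n)) (V : 'M[C]_n) :
  V \is unitarymx -> frob (A *m V) = frob A.
Proof.
move=> uV; apply: complexI; rewrite !frobE trmx_mul map_mxM /= !mulmxA.
by rewrite -(mulmxA A) (unitarymxP uV) mulmx1.
Qed.

Lemma frob_dotmx n (x : 'rV[C]_n) : dotmx x x = (frob x)%:C.
Proof. by rewrite dotmxE frobE /mxtrace big_ord1. Qed.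

Lemma unitarymx_col_nsq n (W : 'M[C]_n) j : W \is unitarymx ->
  \sum_i nsq (W i j) = 1.
Proof.
move=> uW; have := mulVmx (unitarymx_unit uW); rewrite invmx_unitary//.
move=> /matrixP/(_ j j); rewrite !mxE eqxx => WW.
apply: complexI; rewrite rmorph_sum /=; apply: etrans WW; apply: eq_bigr => i _.
by rewrite /= nsqE !mxE mulrC.
Qed.

Lemma frob_unitarymx n (W : 'M[C]_n) : W \is unitarymx -> frob W = n%:R.
Proof.
move=> uW; rewrite /frob exchange_big /=.
under eq_bigr do rewrite unitarymx_col_nsq//.
by rewrite sumr_const card_ord.
Qed.

End Frobenius.

(** * Matrices diagonal in a unitary basis *)

Section Spectral.
Variables (R : realType) (N : nat).
Local Notation C := R[i].
Implicit Types (A B S : 'M[C]_N) (f g : R -> R) (x : 'rV[C]_N).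

Definition eigr A i : R := complex.Re (spectral_diag A 0 i).

Definition udiag (U : 'M[C]_N) (d : 'I_N -> R) : 'M[C]_N :=
  U ^t Num.conj *m diag_mx (\row_i (d i)%:C) *m U.

Lemma mxfunE f A : mxfun f A = udiag (spectralmx A) (fun i => f (eigr A i)).
Proof.
have E : map_mx (fun z => (f (complex.Re z))%:C) (spectral_diag A) =
    \row_i (f (eigr A i))%:C by apply/rowP => i; rewrite !mxE.
by rewrite /mxfun /udiag (invmx_unitary (spectral_unitarymx A)) E.
Qed.

Lemma udiagM U d e : U \is unitarymx ->
  udiag U d *m udiag U e = udiag U (fun i => d i * e i).
Proof.
move=> uU; rewrite /udiag -!mulmxA (mulmxA U) (unitarymxP uU) mul1mx.
congr (_ *m _); rewrite mulmxA mulmx_diag; congr (_ *m _); congr diag_mx.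
by apply/rowP => i; rewrite !mxE rmorphM.
Qed.

Lemma det_udiag U d : U \is unitarymx -> \det (udiag U d) = (\prod_i d i)%:C.
Proof.
move=> uU; rewrite /udiag -invmx_unitary// !det_mulmx mulrAC -det_mulmx.
rewrite mulVmx ?unitarymx_unit// det1 mul1r det_diag rmorph_prod.
by apply: eq_bigr => i _; rewrite mxE.
Qed.

Lemma tr_udiag U d : U \is unitarymx -> \tr (udiag U d) = (\sum_i d i)%:C.
Proof.
move=> uU; rewrite /udiag -invmx_unitary// mxtrace_mulC mulmxA.
rewrite mulmxV ?unitarymx_unit// mul1mx mxtrace_diag rmorph_sum.
by apply: eq_bigr => i _; rewrite mxE.
Qed.

Lemma udiag1 U : U \is unitarymx -> udiag U (fun=> 1) = 1%:M.
Proof.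
move=> uU; rewrite /udiag -invmx_unitary//.
have -> : \row_(i < N) (1%:C : C) = const_mx 1 by apply/rowP => i; rewrite !mxE.
by rewrite diag_const_mx mulmx1 mulVmx// unitarymx_unit.
Qed.

(** By unitary invariance the difference may be multiplied by U on the left and by the adjoint of V
    on the right; its (i, j) entry is then (d_i - e_j) W_ij with W = U V^*. *)
Lemma frob_udiagB U V d e : U \is unitarymx -> V \is unitarymx ->
  frob (udiag U d - udiag V e) =
  \sum_i \sum_j (d i - e j) ^+ 2 * nsq ((U *m V ^t Num.conj) i j).
Proof.
move=> uU uV; rewrite -(frob_unitaryl _ uU).
have uV' : V ^t Num.conj \is unitarymx by rewrite trmxC_unitary.
rewrite -(frob_unitaryr _ uV') mulmxBr mulmxBl /udiag.
rewrite !mulmxA (unitarymxP uU) mul1mx mulmxtVK//.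
apply: eq_bigr => i _; apply: eq_bigr => j _.
rewrite -(mulmxA (diag_mx _)) mul_diag_mx mul_mx_diag !mxE.
by rewrite [X in _ - X]mulrC -mulrBl nsqM -rmorphB nsqR.
Qed.

Definition quad A x : R := complex.Re (dotmx (x *m A) x).

Lemma dotmx_udiag U d x : U \is unitarymx ->
  dotmx (x *m udiag U d) x =
  (\sum_i d i * nsq ((x *m U ^t Num.conj) 0 i))%:C.
Proof.
move=> uU; rewrite dotmxE /udiag.
have -> : x *m (U ^t Num.conj *m diag_mx (\row_i (d i)%:C) *m U) *m x ^t Num.conj =
    (x *m U ^t Num.conj) *m diag_mx (\row_i (d i)%:C) *m (x *m U ^t Num.conj) ^t Num.conj.
  by rewrite trmx_mul map_mxM /= trmxCK !mulmxA.
set y := x *m U ^t Num.conj.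
rewrite mxE rmorph_sum; apply: eq_bigr => i _.
by rewrite mul_mx_diag !mxE /= rmorphM /= nsqE -mulrA mulrCA.
Qed.

Lemma quad_udiag U d x : U \is unitarymx -> quad (udiag U d) x =
  \sum_i d i * nsq ((x *m U ^t Num.conj) 0 i).
Proof. by move=> uU; rewrite /quad dotmx_udiag. Qed.

(* [qle c d A] is the operator inequality c I <= A <= d I. *)
Definition qle (c d : R) A :=
  forall x, c * frob x <= quad A x /\ quad A x <= d * frob x.

Lemma qle_udiag c d U e : U \is unitarymx ->
  (forall i, c <= e i /\ e i <= d) -> qle c d (udiag U e).
Proof.
move=> uU ced x; rewrite quad_udiag//.
have uU' : U ^t Num.conj \is unitarymx by rewrite trmxC_unitary.
rewrite -(frob_unitaryr x uU') /frob big_ord1 !mulr_sumr.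
by split; apply: ler_sum => i _; 
  have [? ?] := ced i; rewrite ler_wpM2r ?nsq_ge0.
Qed.

Lemma udiag_qle c d U e i : U \is unitarymx -> qle c d (udiag U e) ->
  c <= e i /\ e i <= d.
Proof.
(* The test vector is row i of U, the eigenvector with eigenvalue e_i. *)
move=> uU /(_ ('e_i *m U)); rewrite quad_udiag// -mulmxA (unitarymxP uU) mulmx1.
have -> : \sum_i0 e i0 * nsq (('e_i : 'rV[C]_N) 0 i0) = e i.
  rewrite (bigD1 i)//= big1 ?addr0 => [|j ji]; rewrite mxE eqxx /=.
    by rewrite eqxx /nsq /= expr0n addr0 expr1n mulr1.
  by rewrite (negbTE ji) /nsq /= expr0n addr0 mulr0.
rewrite frob_unitaryr// /frob big_ord1 (bigD1 i)//= big1 ?addr0 => [|j ji].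
  by rewrite mxE !eqxx /nsq /= expr0n addr0 expr1n !mulr1.
by rewrite mxE (negbTE ji) /nsq /= expr0n addr0.
Qed.

Lemma udiag_entry_le U d c i j : U \is unitarymx -> (forall k, `|d k| <= c) ->
  nsq (udiag U d i j) <= N%:R * c ^+ 2.
Proof.
move=> uU dc; apply: le_trans (nsq_le_frob _ i j) _.
have uU' : U ^t Num.conj \is unitarymx by rewrite trmxC_unitary.
rewrite (frob_unitaryr _ uU) (frob_unitaryl _ uU') /frob.
apply: (@le_trans _ _ (\sum_(k < N) c ^+ 2)); last first.
  by rewrite sumr_const card_ord mulr_natl.
apply: ler_sum => k _; rewrite (bigD1 k)//= big1 ?addr0 => [|l lk]; rewrite !mxE.
  by rewrite eqxx mulr1n nsqR -real_normK ?num_real// lerXn2r ?nnegrE// (le_trans _ (dc k)).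
by rewrite eq_sym (negbTE lk) mulr0n /nsq /= expr0n addr0.
Qed.

End Spectral.

Lemma pos_family_bounds (R : realType) (I : finType) (h : I -> R) :
  (forall i, 0 < h i) ->
  exists e : R, [/\ 0 < e, e < 1 & forall i, e <= h i /\ h i <= e^-1].
Proof.
(* s dominates every h_i and every inverse, so e = 1/s works; the summand 2 keeps s > 1 even for an
   empty family. *)
move=> h0; pose s := 2 + \sum_i (h i + (h i)^-1).
have t0 i : 0 <= h i + (h i)^-1 by rewrite addr_ge0// ?invr_ge0 ltW.
have hs i : h i + (h i)^-1 <= s.
  rewrite /s (bigD1 i)//= addrCA lerDl addr_ge0//.
  by apply: sumr_ge0.
have s1 : 1 < s.
  have : 0 <= \sum_i (h i + (h i)^-1) by apply: sumr_ge0.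
  by rewrite /s; lra.
have s0 : 0 < s by exact: lt_trans s1.
exists s^-1; split; rewrite ?invr_gt0 ?invf_lt1// => i; rewrite invrK.
have hi : 0 < (h i)^-1 by rewrite invr_gt0.
have := hs i; have := h0 i; split; last by lra.
by rewrite -[h i]invrK lef_pV2 ?posrE//; lra.
Qed.

(** * Functional calculus and order intervals of positive matrices *)

Section Positive.
Variables (R : realType) (N : nat).
Local Notation C := R[i].
Implicit Types (A B S : 'M[C]_N) (f g : R -> R) (x : 'rV[C]_N).

Lemma posmx_unit A : posmxb A -> A \in unitmx.
Proof. by case/andP. Qed.

Lemma posmx_herm A : posmxb A -> A \is hermsymmx.
Proof. by case/andP => /andP[]. Qed.

Lemma posmx_udiag A : posmxb A ->
  A = udiag (spectralmx A) (eigr A) /\ forall i, 0 < eigr A i.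
Proof.
move=> pA; have [AE d0] := posmx_spectral_gt0 pA; split.
  have E : spectral_diag A = \row_i (eigr A i)%:C.
    apply/rowP => i; rewrite mxE /eigr; have := d0 i.
    by case: (spectral_diag A 0 i) => a b; rewrite ltcE => /andP[/eqP/= -> _].
  by rewrite [LHS]AE /udiag (invmx_unitary (spectral_unitarymx A)) E.
by move=> i; have := d0 i; rewrite ltcE => /andP[].
Qed.

Lemma eigr_gt0 A i : posmxb A -> 0 < eigr A i.
Proof. by move=> /posmx_udiag[]. Qed.

Lemma posmx_mxfun_id A : posmxb A -> A = mxfun id A.
Proof. by move=> /posmx_udiag[+ _]; rewrite mxfunE. Qed.

Lemma mxfunM f g A : mxfun f A *m mxfun g A = mxfun (fun t => f t * g t) A.
Proof. by rewrite !mxfunE (udiagM _ _ (spectral_unitarymx A)). Qed.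

Lemma eq_mxfun f g A : posmxb A -> (forall t, 0 < t -> f t = g t) ->
  mxfun f A = mxfun g A.
Proof.
move=> pA fg; rewrite !mxfunE; congr udiag.
by apply/funext => i; rewrite fg// eigr_gt0.
Qed.

Lemma det_mxfun f A : \det (mxfun f A) = (\prod_i f (eigr A i))%:C.
Proof. by rewrite mxfunE (det_udiag _ (spectral_unitarymx A)). Qed.

Lemma tr_mxfun f A : \tr (mxfun f A) = (\sum_i f (eigr A i))%:C.
Proof. by rewrite mxfunE (tr_udiag _ (spectral_unitarymx A)). Qed.

Lemma det_posmx A : posmxb A -> \det A = (\prod_i eigr A i)%:C.
Proof. by move=> pA; rewrite {1}(posmx_mxfun_id pA) det_mxfun. Qed.

Lemma tr_posmx A : posmxb A -> \tr A = (\sum_i eigr A i)%:C.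
Proof. by move=> pA; rewrite {1}(posmx_mxfun_id pA) tr_mxfun. Qed.

Lemma posmx_sqrt A : posmxb A -> posmxb (mxsqrt A).
Proof. by move=> pA; apply: posmx_fun pA => t; rewrite sqrtr_gt0. Qed.

Lemma mxsqrtK A : posmxb A -> mxsqrt A *m mxsqrt A = A.
Proof.
move=> pA; rewrite mxfunM [RHS](posmx_mxfun_id pA); apply: (eq_mxfun pA) => t t0.
by rewrite -expr2 sqr_sqrtr// ltW.
Qed.

Lemma posmx_invE A : posmxb A -> invmx A = mxfun GRing.inv A.
Proof.
move=> pA; have uA := posmx_unit pA.
rewrite -[RHS]mul1mx -(mulVmx uA) -mulmxA {3}(posmx_mxfun_id pA) mxfunM.
have -> : mxfun (fun t => t * t^-1) A = mxfun (fun=> 1) A.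
  by apply: (eq_mxfun pA) => t t0; rewrite mulfV// gt_eqF.
by rewrite [mxfun _ _]mxfunE (udiag1 (spectral_unitarymx A)) mulmx1.
Qed.

Lemma dotmx_posmx A x : posmxb A -> dotmx (x *m A) x = (quad A x)%:C.
Proof.
move=> pA; have [AE _] := posmx_udiag pA.
by rewrite /quad {1 2}AE (dotmx_udiag _ _ (spectral_unitarymx A)).
Qed.

Lemma dotmx_scalar (c : R) x : dotmx (x *m c%:C%:M) x = (c * frob x)%:C.
Proof. by rewrite mul_mx_scalar dotmxE -scalemxAl mxE -dotmxE frob_dotmx rmorphM. Qed.

Lemma hermsym_scalar (c : R) : (c%:C%:M : 'M[C]_N) \is hermsymmx.
Proof.
apply/is_hermitianmxP; rewrite expr0 scale1r tr_scalar_mx map_scalar_mx.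
by congr (_%:M); apply/esym/CrealP/complex_realP; exists c.
Qed.

Lemma hermsymB A B : A \is hermsymmx -> B \is hermsymmx -> A - B \is hermsymmx.
Proof.
move=> /is_hermitianmxP; rewrite expr0 scale1r => hA.
move=> /is_hermitianmxP; rewrite expr0 scale1r => hB.
by apply/is_hermitianmxP; rewrite expr0 scale1r linearB /= map_mxB -hA -hB.
Qed.

Lemma psdmx_qle (c d : R) A : posmxb A ->
  (psdmx (A - c%:C%:M) /\ psdmx (d%:C%:M - A)) <-> qle c d A.
Proof.
move=> pA; have hA := posmx_herm pA.
have E1 x : dotmx (x *m (A - c%:C%:M)) x = (quad A x - c * frob x)%:C.
  rewrite mulmxBr dotmxE mulmxBl !mxE rmorphB /= -dotmx_scalar -dotmx_posmx//.
  by rewrite !dotmxE !mxE.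
have E2 x : dotmx (x *m (d%:C%:M - A)) x = (d * frob x - quad A x)%:C.
  rewrite mulmxBr dotmxE mulmxBl !mxE rmorphB /= -dotmx_scalar -dotmx_posmx//.
  by rewrite !dotmxE !mxE.
split=> [[/andP[_ /asboolP h1] /andP[_ /asboolP h2]] x|h].
  have := h1 x; have := h2 x; rewrite E1 E2 !lecR !subr_ge0.
  by move=> h3 h4; split.
split; apply/andP; split; [exact: hermsymB hA (hermsym_scalar c)| |exact: hermsymB (hermsym_scalar d) hA|].
  by apply/asboolP => x; rewrite E1 lecR subr_ge0; have [] := h x.
by apply/asboolP => x; rewrite E2 lecR subr_ge0; have [] := h x.
Qed.

Lemma qle_mxfun c d A f : posmxb A -> qle c d A -> 0 < c ->
  (forall s t, 0 < s -> s <= t -> f s <= f t) -> qle (f c) (f d) (mxfun f A).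
Proof.
move=> pA qA c0 nf; rewrite mxfunE; apply: (qle_udiag (spectral_unitarymx A)) => i.
have [AE e0] := posmx_udiag pA; rewrite AE in qA.
have [ce ed] := udiag_qle i (spectral_unitarymx A) qA.
by split; apply: nf.
Qed.

Lemma eigr_qle c d A i : posmxb A -> qle c d A -> c <= eigr A i /\ eigr A i <= d.
Proof.
move=> pA; have [AE e0] := posmx_udiag pA; rewrite {1}AE.
exact: udiag_qle (spectral_unitarymx A).
Qed.

Lemma quad_conj A S x : S \is hermsymmx -> quad (S *m A *m S) x = quad A (x *m S).
Proof. by move=> hS; rewrite /quad dotmx_conj. Qed.

(** The form of S A S at x is the form of A at x S, and the squared norm of x S is the form of S S
    at x, so the two pairs of bounds multiply. *)
Lemma qle_conj c d p q A S : S \is hermsymmx -> 0 <= c -> 0 <= d ->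
  qle p q (S *m S) -> qle c d A -> qle (c * p) (d * q) (S *m A *m S).
Proof.
move=> hS c0 d0 qS qA x; rewrite quad_conj//.
have : quad (S *m S) x = frob (x *m S).
  by rewrite -[S in S *m _]mulmx1 quad_conj// /quad mulmx1 frob_dotmx.
have := qS x; move=> [p1 p2] E; rewrite E in p1 p2.
have [a1 a2] := qA (x *m S); split.
  by apply: le_trans a1; rewrite -mulrA ler_wpM2l.
by apply: le_trans a2 _; rewrite -mulrA ler_wpM2l.
Qed.

Lemma posmx_qle_ex A : posmxb A ->
  exists e : R, [/\ 0 < e, e < 1 & qle e e^-1 A].
Proof.
move=> pA; have [AE e0] := posmx_udiag pA.
have [e [h0 h1 he]] := pos_family_bounds e0.
by exists e; split=> //; rewrite AE; apply: (qle_udiag (spectral_unitarymx A)).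
Qed.

Lemma mxfun_entry_le f A c i j : (forall k, `|f (eigr A k)| <= c) ->
  nsq (mxfun f A i j) <= N%:R * c ^+ 2.
Proof. by move=> fc; rewrite mxfunE; exact: udiag_entry_le (spectral_unitarymx A) fc. Qed.

(* With a_i and b_j the eigenvalues of A and B and W the unitary change of
   eigenbasis, |f(A) - f(B)|^2 = sum_ij |f(a_i) - f(b_j)|^2 |W_ij|^2; the case
   f = id also shows that every b_j is close to some a_i. *)
Lemma frob_mxfunB_le f A B (eps eta : R) : posmxb A -> posmxb B ->
  0 < eps -> 0 < eta ->
  (forall i t, `|t - eigr A i| < eta -> `|f t - f (eigr A i)| <= eps) ->
  frob (A - B) < eta ^+ 2 ->
  frob (mxfun f A - mxfun f B) <= N%:R * eps ^+ 2 +
    (((\sum_i `|f (eigr A i)|) *+ 2 + eps) / eta) ^+ 2 * frob (A - B).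
Proof.
move=> pA pB eps0 eta0 fc.
have [AE _] := posmx_udiag pA; have [BE _] := posmx_udiag pB.
have uU := spectral_unitarymx A; have uV := spectral_unitarymx B.
set U := spectralmx A in AE uU; set V := spectralmx B in BE uV.
set W := U *m V ^t Num.conj.
have uV' : V ^t Num.conj \is unitarymx by rewrite trmxC_unitary.
have uW : W \is unitarymx := mul_unitarymx uU uV'.
have dAB : frob (A - B) = \sum_i \sum_j (eigr A i - eigr B j) ^+ 2 * nsq (W i j).
  by rewrite {1}AE {1}BE (frob_udiagB _ _ uU uV).
have dfAB : frob (mxfun f A - mxfun f B) =
    \sum_i \sum_j (f (eigr A i) - f (eigr B j)) ^+ 2 * nsq (W i j).
  by rewrite !mxfunE (frob_udiagB _ _ uU uV).
rewrite dfAB => ltAB; set K := _ / eta.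
have close j : exists k, `|eigr B j - eigr A k| < eta.
  apply: contrapT => /forallNP far.
  have : eta ^+ 2 <= frob (A - B).
    rewrite dAB exchange_big /= (bigD1 j)//= -[leLHS]mulr1 -(unitarymx_col_nsq j uW).
    rewrite mulr_sumr -[leLHS]addr0 lerD//; last first.
      by do 2! apply: sumr_ge0 => ? _; rewrite mulr_ge0 ?sqr_ge0 ?nsq_ge0.
    apply: ler_sum => k _; rewrite ler_wpM2r ?nsq_ge0//.
    have /negP := far k; rewrite -leNgt distrC => h.
    by rewrite -[leRHS]real_normK ?num_real// lerXn2r ?nnegrE// ltW.
  by rewrite leNgt ltAB.
have fle k : `|f (eigr A k)| <= \sum_i `|f (eigr A i)|.
  by rewrite (bigD1 k)//= lerDl sumr_ge0.
(* A pair closer than eta costs eps. For a far pair, f(b_j) is controlled through an eigenvalue a_k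
   near b_j, so the difference is at most K eta, hence at most K |a_i - b_j|; this is the origin of
   K. *)
have term i j : (f (eigr A i) - f (eigr B j)) ^+ 2 <=
    eps ^+ 2 + K ^+ 2 * (eigr A i - eigr B j) ^+ 2.
  have [near|far] := ltP `|eigr B j - eigr A i| eta.
    have h := fc _ _ near; rewrite distrC in h.
    apply: (@le_trans _ _ (eps ^+ 2)); last by rewrite lerDl mulr_ge0 ?sqr_ge0.
    by rewrite -[leLHS]real_normK ?num_real// lerXn2r ?nnegrE// ltW.
  apply: (@le_trans _ _ (K ^+ 2 * (eigr A i - eigr B j) ^+ 2)); last first.
    by rewrite lerDr sqr_ge0.
  rewrite -exprMn -[leLHS]real_normK ?num_real// -[leRHS]real_normK ?num_real//.
  rewrite lerXn2r ?nnegrE// normrM (distrC (eigr A i)).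
  have [k nk] := close j; have h := fc _ _ nk.
  have s0 : 0 <= \sum_i `|f (eigr A i)| by rewrite sumr_ge0.
  have K0 : 0 <= K by rewrite divr_ge0 ?addr_ge0 ?mulrn_wge0 ?(ltW eps0) ?(ltW eta0).
  apply: (@le_trans _ _ (K * eta)); last by rewrite (ger0_norm K0) ler_wpM2l.
  rewrite /K divfK ?gt_eqF//.
  rewrite -(subrK (f (eigr A k)) (f (eigr A i))) -addrA.
  apply: le_trans (ler_normD _ _) _; rewrite lerD//; last by rewrite distrC.
  by apply: le_trans (ler_normB _ _) _; rewrite mulr2n lerD.
apply: (@le_trans _ _ (\sum_i \sum_j
    (eps ^+ 2 + K ^+ 2 * (eigr A i - eigr B j) ^+ 2) * nsq (W i j))).
  by do 2! apply: ler_sum => ? _; rewrite ler_wpM2r ?nsq_ge0.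
have -> : \sum_i \sum_j (eps ^+ 2 + K ^+ 2 * (eigr A i - eigr B j) ^+ 2) * nsq (W i j)
    = eps ^+ 2 * frob W + K ^+ 2 * frob (A - B).
  rewrite dAB /frob !mulr_sumr -big_split /=; apply: eq_bigr => i _.
  rewrite !mulr_sumr -big_split /=; apply: eq_bigr => j _.
  by ring.
by rewrite (frob_unitarymx uW) mulrC.
Qed.

End Positive.

Lemma mxfun1E (R : realType) (f : R -> R) (a : R) : 0 < a ->
  mxfun f (a%:C%:M : 'M[R[i]]_1) = (f a)%:C%:M.
Proof.
move=> a0; have pa := @posmx_scalar R 1 a a0.
have [AE _] := posmx_udiag pa.
have E (d : 'I_1 -> R) : udiag (spectralmx (a%:C%:M : 'M[R[i]]_1)) d = (d 0)%:C%:M.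
  rewrite /udiag -(invmx_unitary (spectral_unitarymx _)).
  have -> : diag_mx (\row_i (d i)%:C) = (d 0)%:C%:M :> 'M[R[i]]_1.
    by apply/matrixP => i j; rewrite !mxE !ord1.
  by rewrite mul_mx_scalar -scalemxAl mulVmx ?spectral_unit// scalemx1.
rewrite E in AE; rewrite mxfunE E.
have /matrixP/(_ 0 0) := AE; rewrite !mxE eqxx !mulr1n => /complexI <-.
by [].
Qed.

(** * Submultiplicativity and entrywise bounds *)

Section FrobeniusMore.
Variable R : realType.
Local Notation C := R[i].

Lemma nsqD_le (z w : C) : nsq (z + w) <= 2 * (nsq z + nsq w).
Proof. by case: z w => [a b] [c d]; rewrite /nsq /=;
  have := sqr_ge0 (a - c); have := sqr_ge0 (b - d); nra.
Qed.

(** Iterating |z + w|^2 <= 2 (|z|^2 + |w|^2) produces the crude constant 2^n; the estimates built on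
    it only ask for some constant depending on n. *)
Lemma nsq_sum_le n (z : 'I_n -> C) :
  nsq (\sum_i z i) <= 2 ^+ n * \sum_i nsq (z i).
Proof.
elim: n z => [|n IHn] z; first by rewrite !big_ord0 mulr0 /nsq /= expr0n addr0.
rewrite !big_ord_recl; apply: le_trans (nsqD_le _ _) _.
have := IHn (fun i => z (lift ord0 i)).
have := nsq_ge0 (z ord0); have : 1 <= 2 ^+ n :> R by rewrite exprn_ege1// ler1n.
by rewrite exprS; nra.
Qed.

Lemma frob_mul_le m n p (A : 'M[C]_(m, n)) (B : 'M[C]_(n, p)) :
  frob (A *m B) <= 2 ^+ n * frob A * frob B.
Proof.
apply: (@le_trans _ _ (\sum_i \sum_j 2 ^+ n * \sum_k nsq (A i k) * nsq (B k j))).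
  apply: ler_sum => i _; apply: ler_sum => j _; rewrite mxE.
  by apply: le_trans (nsq_sum_le _) _; under eq_bigr do rewrite nsqM.
rewrite -mulrA /frob mulr_suml mulr_sumr; apply: ler_sum => i _.
rewrite -mulr_sumr ler_wpM2l ?exprn_ge0// exchange_big mulr_suml /=.
apply: ler_sum => k _; rewrite -mulr_sumr ler_wpM2l ?nsq_ge0//.
rewrite [leRHS](bigD1 k)//= lerDl.
by do 2! apply: sumr_ge0 => ? _; exact: nsq_ge0.
Qed.

Lemma frob0 m n : frob (0 : 'M[C]_(m, n)) = 0.
Proof.
apply: big1 => i _; apply: big1 => j _.
by rewrite mxE /nsq /= expr0n addr0.
Qed.

Lemma frobN m n (A : 'M[C]_(m, n)) : frob (- A) = frob A.
Proof.
apply: eq_bigr => i _; apply: eq_bigr => j _.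
by rewrite mxE; case: (A i j) => a b; rewrite /nsq /= !sqrrN.
Qed.

Lemma frobB_sym m n (A B : 'M[C]_(m, n)) : frob (A - B) = frob (B - A).
Proof. by rewrite -frobN opprB. Qed.

Lemma normC_lt_nsq (z : C) (e : R) : 0 < e -> nsq z < e ^+ 2 -> `|z| < e%:C.
Proof.
move=> e0 ze; rewrite normc_def ltcR -(ger0_norm (ltW e0)) -sqrtr_sqr.
by rewrite ltr_sqrt// exprn_gt0.
Qed.

Lemma Re_lt_nsq (z : C) (e : R) : 0 < e -> nsq z < e ^+ 2 -> `|complex.Re z| < e.
Proof.
move=> e0 ze; have := normC_lt_nsq e0 ze.
by move=> /(le_lt_trans (normc_ge_Re z)); rewrite ltcR.
Qed.

Lemma Im_lt_nsq (z : C) (e : R) : 0 < e -> nsq z < e ^+ 2 -> `|complex.Im z| < e.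
Proof.
move=> e0; case: z => a b ze; have := @Re_lt_nsq (b +i* a) e e0; apply.
by move: ze; rewrite /nsq /= addrC.
Qed.

End FrobeniusMore.

Lemma cvg_det (K : numFieldType) T (F : set_system T) n (G : T -> 'M[K]_n)
    (L : 'M[K]_n) : Filter F ->
  (forall i j, G t i j @[t --> F] --> L i j) -> \det (G t) @[t --> F] --> \det L.
Proof.
move=> FF GL; rewrite /determinant.
apply: cvg_big => [|s _]; first exact: add_continuous.
apply: cvgM; first exact: cvg_cst.
by apply: cvg_big => [|i _]; [exact: mul_continuous|exact: GL].
Qed.

(** * Continuity on the cone of positive matrices *)

Section Topology.
Variables (R : realType) (N : nat).
Local Notation C := R[i].
Implicit Types (A B : posop R N).

Lemma hnormE (x : 'rV[C]_N) : hnorm (@dotmx _ N) x = Num.sqrt (frob x).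
Proof. by rewrite /hnorm /= frob_dotmx. Qed.

Lemma opnorm_set_le (D : 'M[C]_N) : ubound
  [set hnorm (@dotmx _ N) (x *m D) | x in [set x | hnorm (@dotmx _ N) x <= 1]]
  (Num.sqrt (2 ^+ N * frob D)).
Proof.
move=> _ [x /= x1 <-]; rewrite hnormE in x1; rewrite hnormE ler_wsqrtr//.
apply: le_trans (frob_mul_le _ _) _.
rewrite ler_wpM2r ?frob_ge0// -[leRHS]mulr1 ler_wpM2l ?exprn_ge0//.
by rewrite -ler_sqrt// sqrtr1.
Qed.

Lemma opnorm_le (D : 'M[C]_N) : opnorm D <= Num.sqrt (2 ^+ N * frob D).
Proof.
apply: ge_sup; last exact: opnorm_set_le.
by exists (hnorm (@dotmx _ N) (0 *m D)), 0 => //=; rewrite hnormE frob0 sqrtr0.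
Qed.

Lemma opnorm_ge0 (D : 'M[C]_N) : 0 <= opnorm D.
Proof.
have : hnorm (@dotmx _ N) (0 *m D) <= opnorm D.
  apply: ub_le_sup; first by exists (Num.sqrt (2 ^+ N * frob D)); exact: opnorm_set_le.
  by exists 0 => //=; rewrite hnormE frob0 sqrtr0.
by apply: le_trans; rewrite hnormE sqrtr_ge0.
Qed.

(** Each of the N rows of D is the image of a unit basis vector. *)
Lemma frob_le_opnorm (D : 'M[C]_N) : frob D <= N%:R * opnorm D ^+ 2.
Proof.
have h (i : 'I_N) : frob (('e_i : 'rV[C]_N) *m D) <= opnorm D ^+ 2.
  have : hnorm (@dotmx _ N) ('e_i *m D) <= opnorm D.
    apply: ub_le_sup; first by exists (Num.sqrt (2 ^+ N * frob D)); exact: opnorm_set_le.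
    exists 'e_i => //=; rewrite hnormE /frob big_ord1 (bigD1 i)//= big1 ?addr0.
      by rewrite mxE !eqxx /nsq /= expr0n addr0 expr1n sqrtr1.
    by move=> j ji; rewrite mxE (negbTE ji) /nsq /= expr0n addr0.
  rewrite hnormE => le; rewrite -[leLHS]sqr_sqrtr ?frob_ge0//.
  by rewrite ler_sqr // nnegrE ?sqrtr_ge0 ?opnorm_ge0.
have -> : frob D = \sum_i frob (('e_i : 'rV[C]_N) *m D).
  apply: eq_bigr => i _; rewrite /frob big_ord1; apply: eq_bigr => j _.
  by rewrite -rowE mxE.
apply: le_trans (ler_sum _ (fun i _ => h i)) _.
by rewrite sumr_const card_ord mulr_natl.
Qed.

(* The filter of neighbourhoods of [A]; the Frobenius norm is equivalent to the
   operator norm of [posop_open] and easier to compute with. *)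
Definition pnbhs A : set_system (posop R N) := filter_from [set e : R | 0 < e]
  (fun e => [set B | frob (posmx B - posmx A) < e]).

Global Instance pnbhs_filter A : Filter (pnbhs A).
Proof.
apply: filter_from_filter; first by exists 1; rewrite /= ltr01.
move=> e f /= e0 f0; exists (Num.min e f); first by rewrite /= lt_min e0.
by move=> B /=; rewrite lt_min => /andP[].
Qed.

Lemma posop_openP (U : set (posop R N)) :
  posop_open U <-> forall A, U A -> pnbhs A U.
Proof.
split=> oU A UA; have [e e0 h] := oU A UA.
  have k0 : 0 < 2 ^+ N :> R by rewrite exprn_gt0.
  exists (e ^+ 2 / 2 ^+ N) => /=; first by rewrite divr_gt0 ?exprn_gt0.
  move=> B /= BA; apply: h; apply: le_lt_trans (opnorm_le _) _.
  rewrite -[ltRHS](ger0_norm (ltW e0)) -sqrtr_sqr ltr_sqrt ?exprn_gt0//.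
  by rewrite mulrC -ltr_pdivlMr.
(* The radius is at most 1 so that z^2 <= z, and n exceeds N by 1 so that the division is legitimate
   for N = 0. *)
pose n : R := N%:R + 1; have n0 : 0 < n by rewrite ltr_wpDl.
exists (Num.min 1 (e / n)); first by rewrite lt_min ltr01 divr_gt0.
move=> B; rewrite lt_min => /andP[B1 Bn]; apply: h => /=.
apply: le_lt_trans (frob_le_opnorm _) _.
move: B1 Bn; set z := opnorm _ => z1; rewrite ltr_pdivlMr// => zn.
have z0 : 0 <= z by exact: opnorm_ge0.
have : 0 <= N%:R :> R by [].
have : z * z <= z by nra.
by move: zn; rewrite /n expr2; nra.
Qed.

Lemma pnbhs_frob A (e : R) : 0 < e ->
  \forall B \near pnbhs A, frob (posmx B - posmx A) < e.
Proof. by move=> e0; exists e. Qed.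

Lemma posop_open_measurable (U : set (posop R N)) : posop_open U -> measurable U.
Proof. exact: sub_sigma_algebra. Qed.

Definition rcont (h : posop R N -> R) := forall A, h B @[B --> pnbhs A] --> h A.

Lemma rcont_open (h : posop R N -> R) (V : set R) : rcont h -> open V ->
  posop_open (h @^-1` V).
Proof.
move=> ch oV; apply/posop_openP => A VA; apply: (ch A).
exact: open_nbhs_nbhs.
Qed.

Lemma rcont_measurable (h : posop R N -> R) : rcont h -> measurable_fun setT h.
Proof.
move=> ch; apply: (measurability _ (RGenOInfty.measurableE R)).
move=> /= _ [_ [a ->]] <-; rewrite setTI; apply: posop_open_measurable.
exact: rcont_open.
Qed.

Definition mxcont m (G : posop R N -> 'M[C]_m) := forall A (e : R), 0 < e ->
  \forall B \near pnbhs A, frob (G B - G A) < e.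

Lemma mxcont_Re m (G : posop R N -> 'M[C]_m) i j : mxcont G ->
  rcont (fun B => complex.Re (G B i j)).
Proof.
move=> cG A; apply/cvgrPdist_lt => e e0.
have e2 : 0 < e ^+ 2 by rewrite exprn_gt0.
apply: filterS (cG A _ e2) => B BA; rewrite distrC -raddfB /=.
apply: Re_lt_nsq => //; apply: le_lt_trans BA.
by have := nsq_le_frob (G B - G A) i j; rewrite !mxE.
Qed.

Lemma mxcont_Im m (G : posop R N -> 'M[C]_m) i j : mxcont G ->
  rcont (fun B => complex.Im (G B i j)).
Proof.
move=> cG A; apply/cvgrPdist_lt => e e0.
have e2 : 0 < e ^+ 2 by rewrite exprn_gt0.
apply: filterS (cG A _ e2) => B BA; rewrite distrC -raddfB /=.
apply: Im_lt_nsq => //; apply: le_lt_trans BA.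
by have := nsq_le_frob (G B - G A) i j; rewrite !mxE.
Qed.

Lemma mxcont_le m p (k : R) (G : posop R N -> 'M[C]_m) (H : posop R N -> 'M[C]_p) :
  (forall A B, frob (H B - H A) <= k * frob (G B - G A)) -> mxcont G -> mxcont H.
Proof.
move=> le cG A e e0; pose k' := `|k| + 1.
have k0 : 0 < k' by rewrite ltr_wpDl.
have ek : 0 < e / k' by rewrite divr_gt0.
apply: filterS (cG A _ ek) => B; rewrite ltr_pdivlMr// mulrC.
apply: le_lt_trans; apply: le_trans (le A B) _.
by rewrite ler_wpM2r ?frob_ge0// /k' (le_trans (ler_norm _))// lerDl.
Qed.

Lemma mxcont_id : mxcont (@posmx R N).
Proof. by move=> A e e0; exact: pnbhs_frob. Qed.

Lemma mxcont_conj m p (S : 'M[C]_(p, m)) (T : 'M[C]_(m, p))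
    (G : posop R N -> 'M[C]_m) : mxcont G -> mxcont (fun B => S *m G B *m T).
Proof.
apply: (@mxcont_le _ _ (2 ^+ m * (2 ^+ m * frob S) * frob T)) => A B.
rewrite -mulmxBl -mulmxBr; apply: le_trans (frob_mul_le _ _) _.
rewrite [leRHS]mulrAC ler_wpM2r ?frob_ge0// -mulrA ler_wpM2l ?exprn_ge0//.
exact: frob_mul_le.
Qed.

(** Finitely many eigenvalues, all positive, share one modulus of continuity eta; [frob_mxfunB_le]
    then bounds the change of f(G) by m eps^2 plus a multiple of the change of G. *)
Lemma mxcont_mxfun m (f : R -> R) (G : posop R N -> 'M[C]_m) : mxcont G ->
  (forall B, posmxb (G B)) -> (forall t, 0 < t -> {for t, continuous f}) ->
  mxcont (fun B => mxfun f (G B)).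
Proof.
move=> cG pG cf A e e0; pose m' : R := m%:R + 1.
have m0 : 0 < m' by rewrite ltr_wpDl.
(* Half of e pays for m eps^2; the other half pays for the term with K. *)
pose eps := Num.sqrt (e / 2 / m').
have eps0 : 0 < eps by rewrite sqrtr_gt0 !divr_gt0.
have epsE : m%:R * eps ^+ 2 <= e / 2.
  have e2 : 0 < e / 2 by rewrite divr_gt0.
  rewrite sqr_sqrtr; last by rewrite ltW// divr_gt0.
  by rewrite mulrA ler_pdivrMr// mulrC ler_wpM2l ?lerDl// ltW.
have [eta eta0 etaP] : exists2 eta : R, 0 < eta &
    forall i t, `|t - eigr (G A) i| < eta -> `|f t - f (eigr (G A) i)| <= eps.
  have hi i : exists eta : R, 0 < eta /\
      forall t, `|t - eigr (G A) i| < eta -> `|f t - f (eigr (G A) i)| <= eps.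
    have /cvgrPdist_le/(_ eps eps0)/nbhs_ballP[d d0 hd] := cf _ (eigr_gt0 i (pG A)).
    exists d; split=> // t td; rewrite distrC; apply: hd.
    by rewrite /ball /= distrC.
  have [h hP] := choice hi.
  have [d [d0 _ hd]] := pos_family_bounds (fun i => (hP i).1).
  exists d => // i t td; apply: (hP i).2; apply: lt_le_trans td _.
  by have [] := hd i.
pose K := ((\sum_i `|f (eigr (G A) i)|) *+ 2 + eps) / eta.
have K0 : 0 < K ^+ 2 + 1 by rewrite ltr_wpDl ?sqr_ge0.
have d0 : 0 < Num.min (eta ^+ 2) (e / 2 / (K ^+ 2 + 1)).
  by rewrite lt_min exprn_gt0//= !divr_gt0.
apply: filterS (cG A _ d0) => B; rewrite lt_min => /andP[B1].
rewrite ltr_pdivlMr// => B2; rewrite frobB_sym; rewrite frobB_sym in B1 B2.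
apply: le_lt_trans (frob_mxfunB_le (pG A) (pG B) eps0 eta0 etaP B1) _.
rewrite -/K; have := frob_ge0 (G A - G B); move: B2 epsE.
by set q := frob _; set s := _ * eps ^+ 2; nra.
Qed.

Lemma rcont_quad (x : 'rV[C]_N) : rcont (fun B => quad (posmx B) x).
Proof.
have := @mxcont_Re 1 _ 0 0 (mxcont_conj x (x ^t Num.conj) mxcont_id).
by under eq_fun do rewrite -dotmxE.
Qed.

(** A bound violated at one vector x stays violated nearby, because the form at a fixed x is
    continuous. *)
Lemma posop_open_not_qle (c d : R) : posop_open (~` [set B : posop R N | qle c d B]).
Proof.
apply/posop_openP => A /existsNP[x /not_andP[|] /negP]; rewrite -ltNge => Ax.
  apply: filterS (cvgr_lt _ (@rcont_quad x A) _ Ax) => B Bx /(_ x)[].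
  by rewrite leNgt Bx.
apply: filterS (cvgr_gt _ (@rcont_quad x A) _ Ax) => B Bx /(_ x)[_].
by rewrite leNgt Bx.
Qed.

Lemma rcont_Re_det : rcont (fun B => complex.Re (\det (posmx B))).
Proof.
move=> A; pose K : numFieldType := R[i].
have cdet : (\det (posmx B : 'M[K]_N) : K) @[B --> pnbhs A] --> (\det (posmx A : 'M[K]_N) : K).
  apply: cvg_det => i j; apply/cvgrPdist_lt => e e0.
  have eE : e = (complex.Re e)%:C.
    by move: e0; rewrite ltcE; case: e => a b /andP[/eqP/= -> _].
  have r0 : 0 < complex.Re e by move: e0; rewrite ltcE => /andP[].
  have e2 : 0 < complex.Re e ^+ 2 by rewrite exprn_gt0.
  apply: filterS (pnbhs_frob A e2) => B BA; rewrite distrC eE.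
  apply: normC_lt_nsq => //; apply: le_lt_trans BA.
  by have := nsq_le_frob (posmx B - posmx A) i j; rewrite !mxE.
apply/cvgrPdist_lt => e e0; have e0' : 0 < e%:C by rewrite ltcR.
move/cvgrPdist_lt : cdet => /(_ _ e0'); apply: filterS => B BA.
by rewrite -raddfB /= -ltcR; apply: le_lt_trans BA; exact: normc_ge_Re.
Qed.

Lemma rcont_detroot : rcont (@detroot R N).
Proof.
move=> A; have dA : 0 < complex.Re (\det (posmx A)).
  by have := posmx_det_gt0 (posmxP A); rewrite ltcE => /andP[].
have E B : detroot B = expR (N%:R^-1 * ln (complex.Re (\det (posmx B)))).
  have := posmx_det_gt0 (posmxP B); rewrite ltcE => /andP[_ /= dB].
  by rewrite /detroot /powR gt_eqF.
have cg : {for complex.Re (\det (posmx A)), continuous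
    (fun t : R => expR (N%:R^-1 * ln t))}.
  apply: (@continuous_comp _ _ _ (fun t : R => N%:R^-1 * ln t) expR); last exact: continuous_expR.
  by apply: continuousM; [exact: cst_continuous|exact: continuous_ln].
rewrite E (funext E); exact: (continuous_cvg _ cg (rcont_Re_det (A := A))).
Qed.

Definition pcont m (phi : posop R N -> posop R m) :=
  mxcont (fun B => posmx (phi B)).

End Topology.

Lemma pcont_open (R : realType) n m (phi : posop R n -> posop R m) (U : set (posop R m)) :
  pcont phi -> posop_open U -> posop_open (phi @^-1` U).
Proof.
move=> cphi /posop_openP oU; apply/posop_openP => A UA.
have [e e0 eU] := oU _ UA.
by apply: filterS (cphi A e e0) => B; exact: eU.
Qed.

Lemma pcont_measurable (R : realType) n m (phi : posop R n -> posop R m) :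
  pcont phi -> measurable_fun setT phi.
Proof.
move=> cphi; apply: (@measurability _ _ _ _ _ _ (@posop_open R m)) => //.
move=> _ [U oU <-]; rewrite setTI; apply: posop_open_measurable.
exact: pcont_open.
Qed.

Lemma detroot_op_pcont (R : realType) n : pcont (@detroot_op R n).
Proof.
move=> A e e0; have e1 : 0 < Num.sqrt e by rewrite sqrtr_gt0.
have /cvgrPdist_lt/(_ _ e1) := @rcont_detroot R n A.
apply: filterS => B; rewrite distrC => BA.
rewrite /= -raddfB /= /frob !big_ord1 mxE mulr1n -rmorphB nsqR.
rewrite -real_normK ?num_real// -[ltRHS](sqr_sqrtr (ltW e0)).
by rewrite ltrXn2r// ?nnegrE ?sqrtr_ge0.
Qed.

Lemma opmean_app_pcont (R : realType) (sigma : opmean R) n (X : posop R n) :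
  gcv sigma \/ gcc sigma -> pcont (opmean_app sigma X).
Proof.
move=> gs; apply: mxcont_conj; apply: mxcont_mxfun.
- by apply: mxcont_conj; exact: mxcont_id.
- move=> B; apply: posmx_conj (posmxP B).
  by apply: posmx_inv; apply: posmx_sqrt; exact: posmxP.
- exact: repf_continuous.
Qed.

(** * Push-forwards, integrability and finitely supported measures *)

Section Probability.
Variable R : realType.

Lemma pushforward_probability d d' (T : measurableType d) (T' : measurableType d')
    (P : probability T R) (phi : T -> T') : measurable_fun setT phi ->
  exists Q : probability T' R, pushforward P phi = Q.
Proof.
move=> mphi; pose X : {mfun T >-> T'} :=
  MeasurableFun.Pack (MeasurableFun.Class (isMeasurableFun.Build _ _ _ _ _ mphi)).
by exists (distribution P X).
Qed.

(** Measures in [Pinfty] control a function on their support alone; its complement is negligible. *)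
Lemma ae_bounded_integrable d (T : measurableType d) (P : probability T R)
    (S : set T) (h : T -> R) (c : R) : measurable S -> P S = 1%E ->
  measurable_fun setT h -> (forall t, S t -> `|h t| <= c) ->
  P.-integrable setT (EFin \o h).
Proof.
move=> mS PS mh hc.
have PC : P (~` S) = 0%E by rewrite probability_setC// PS subee.
have PF : (P S < +oo)%E by rewrite PS ltry.
apply/(negligible_integrable (N := ~` S)) => //.
- exact: measurableC.
- exact/measurable_EFinP.
rewrite setTD setCK; apply: measurable_bounded_integrable => //.
- exact: measurable_funTS.
- by exists c; split; [exact: num_real|move=> x cx t /= /hc /le_trans; apply; exact: ltW].
Qed.

Lemma Rintegral_sum d (T : measurableType d) (P : {measure set T -> \bar R})
    I (r : seq I) (f : I -> T -> R) :
  (forall i, P.-integrable setT (EFin \o f i)) ->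
  P.-integrable setT (EFin \o (fun t => \sum_(i <- r) f i t)) /\
  Rintegral P setT (fun t => \sum_(i <- r) f i t) =
  \sum_(i <- r) Rintegral P setT (f i).
Proof.
move=> If; elim: r => [|i r [IH1 IH2]].
  rewrite big_nil; have -> : (fun t => \sum_(i <- [::]) f i t) = cst 0.
    by apply/funext => t; rewrite big_nil.
  by split; [exact: integrable0|rewrite Rintegral_cst// mul0r].
have E : (fun t => \sum_(j <- i :: r) f j t) =
    (fun t => f i t + \sum_(j <- r) f j t).
  by apply/funext => t; rewrite big_cons.
rewrite E big_cons -IH2 RintegralD//; split=> //.
exact: integrableD (If i) IH1.
Qed.

(** The weights are placed on the indices rather than on the points, so that two families with the
    same weights become functions on one probability space. *)
Lemma discrete_probability n (w : 'I_n -> R) : (forall j, 0 <= w j) ->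
  \sum_j w j = 1 -> exists P : probability nat R,
  forall U, P U = (\sum_(j < n) (w j)%:E * \d_(nat_of_ord j) U)%E.
Proof.
move=> w0 w1; pose v k : {nonneg R} :=
  if insub k is Some j then NngNum (w0 j) else NngNum (lexx 0).
pose m := msum (fun k => mscale (v k) (\d_k : {measure set nat -> \bar R})) n.
have mE U : m U = (\sum_(j < n) (w j)%:E * \d_(nat_of_ord j) U)%E.
  by apply: eq_bigr => j _; rewrite /= /mscale /= /v valK.
have mT : m setT = 1%E.
  rewrite mE; under eq_bigr do rewrite diracT mule1.
  by rewrite sumEFin w1.
pose Q : probability nat R := HB.pack_for (probability nat R) m
  (Measure_isProbability.Build _ _ _ m mT).
by exists Q.
Qed.

(** Indices from n on are sent to [point]; they carry no mass. *)
Lemma dirac_sum_pushforward d (T : measurableType d) n (w : 'I_n -> R)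
    (a : 'I_n -> T) (P : probability nat R) :
  (forall U, P U = (\sum_(j < n) (w j)%:E * \d_(nat_of_ord j) U)%E) ->
  (fun U => \sum_(j < n) (w j)%:E * \d_(a j) U)%E =
  pushforward P (fun k => if insub k is Some j then a j else point).
Proof.
move=> PE; apply/funext => U; rewrite /pushforward PE.
apply: eq_bigr => j _; congr (_ * _)%E; rewrite !diracE; congr (_%:R%:E).
by congr nat_of_bool; apply/idP/idP; rewrite !inE /= valK.
Qed.

End Probability.

(** * Stability of [Pinfty] and integration against its members *)

Section Supports.
Variable R : realType.

Lemma supp_measurable n (mu : set (posop R n) -> \bar R) : measurable (supp mu).
Proof.
rewrite -[supp mu]setCK; apply: measurableC; apply: posop_open_measurable.
move=> A /existsNP[U /not_implyP[oU /not_implyP[UA mU]]].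
have [e e0 eU] := oU A UA; exists e => // B /eU UB SB.
exact/mU/SB.
Qed.

(** The complement of an order interval is open, so a support point lying in it would give it
    positive mass. *)
Lemma supp_not_null n (mu : set (posop R n) -> \bar R) A (c d : R) : supp mu A ->
  mu (~` [set B | qle c d (posmx B)]) = 0%E -> qle c d A.
Proof.
move=> SA m0; apply: contrapT => nA.
by have := SA _ (@posop_open_not_qle R n c d) nA; rewrite m0 ltxx.
Qed.

Lemma Pinfty_pushforward n m (mu : set (posop R n) -> \bar R)
    (phi : posop R n -> posop R m) : pcont phi ->
  (forall e : R, 0 < e -> e < 1 -> exists e' : R, [/\ 0 < e', e' < 1 &
    forall A, qle e e^-1 (posmx A) -> qle e' e'^-1 (posmx (phi A))]) ->
  Pinfty mu -> Pinfty (pushforward mu phi).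
Proof.
move=> cphi bphi [[P ->] PS [e [e0 e1 eS]]].
have mphi := pcont_measurable cphi.
have mS := supp_measurable P.
have mpre U : measurable U -> measurable (phi @^-1` U).
  by move=> mU; rewrite -[X in measurable X]setTI; exact: mphi.
split; first exact: pushforward_probability.
  have mS' := mpre _ (supp_measurable (pushforward P phi)).
  apply/eqP; rewrite eq_le probability_le1//= -PS le_measure ?inE//.
  (* Preimages of open sets are open, so [phi] maps the support of P into the support of the image
     measure, which therefore has full mass. *)
  move=> A SA U oU UA; apply: SA; last by [].
  exact: pcont_open oU.
have [e' [e0' e1' he']] := bphi e e0 e1.
exists e'; split=> // A SA; apply/psdmx_qle; first exact: posmxP.
apply: (supp_not_null SA); apply/eqP.
rewrite /pushforward eq_le; apply/andP; split; last exact: measure_ge0.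
(* A point whose image leaves the new order interval lies outside the support of P. *)
apply: (@le_trans _ _ (P (~` supp P))); last by rewrite probability_setC// PS subee.
apply: le_measure; rewrite ?inE.
- by apply: mpre; apply: posop_open_measurable; exact: posop_open_not_qle.
- exact: measurableC.
- move=> B /= nB SB; apply: nB; apply: he'.
  by apply/psdmx_qle; [exact: posmxP|exact: eS].
Qed.

Lemma qleW n (c d c' d' : R) (A : 'M[R[i]]_n) :
  c' <= c -> d <= d' -> qle c d A -> qle c' d' A.
Proof.
move=> cc dd qA x; have [q1 q2] := qA x; split.
  by apply: le_trans q1; rewrite ler_wpM2r ?frob_ge0.
by apply: (le_trans q2); rewrite ler_wpM2r ?frob_ge0.
Qed.

Lemma Pinfty_dirac_sum n m (w : 'I_n -> R) (a : 'I_n -> posop R m) :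
  (forall j, 0 <= w j) -> \sum_j w j = 1 ->
  Pinfty (fun U => \sum_(j < n) (w j)%:E * \d_(a j) U)%E.
Proof.
move=> w0 w1; set mu := fun U => _.
have [P PE] := discrete_probability w0 w1.
split.
- rewrite /mu (dirac_sum_pushforward a PE); apply: pushforward_probability.
  by move=> _ Y _.
- rewrite /mu -[RHS]/(1%:E) -w1 -sumEFin; apply: eq_bigr => j _.
  (* An atom of weight zero may lie off the support, but it contributes nothing to the sum. *)
  have [->|wj] := eqVneq (w j) 0; first by rewrite mul0e.
  rewrite diracE mem_set ?mule1// => U oU Ua.
  apply: (@lt_le_trans _ _ (w j)%:E); first by rewrite lte_fin lt0r wj w0.
  rewrite /mu (bigD1 j)//= diracE mem_set// mule1 leeDl// sume_ge0// => k _.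
  by rewrite mule_ge0// lee_fin.
have [e' /= he'] := choice (fun j => posmx_qle_ex (posmxP (a j))).
have [e [e0 e1 ee]] := pos_family_bounds (fun j => let: And3 h _ _ := he' j in h).
exists e; split=> // A SA; apply/psdmx_qle; first exact: posmxP.
apply: (supp_not_null SA); rewrite /mu big1// => j _.
rewrite diracE memNset ?mule0//=; apply; have [p0 _] := he' j.
by apply: qleW; [exact: (ee j).1|rewrite lef_pV2 ?posrE//; exact: (ee j).1].
Qed.

Lemma Pinfty_pushforward_integrable d (T : measurableType d) n (P : probability T R)
    (phi : T -> posop R n) : measurable_fun setT phi ->
  Pinfty (pushforward P phi) -> exists e : R, [/\ 0 < e, e < 1 &
  forall h : posop R n -> R, rcont h ->
    (exists c, forall A, qle e e^-1 (posmx A) -> `|h A| <= c) ->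
    P.-integrable setT (EFin \o (h \o phi)) /\
    fine (\int[pushforward P phi]_A (h A)%:E) = Rintegral P setT (h \o phi)].
Proof.
move=> mphi [_ PS [e [e0 e1 eS]]]; exists e; split=> // h ch [c hc].
have mh := rcont_measurable ch.
have mpre U : measurable U -> measurable (phi @^-1` U).
  by move=> mU; rewrite -[X in measurable X]setTI; exact: mphi.
have Ih : P.-integrable setT (EFin \o (h \o phi)).
  apply: (ae_bounded_integrable (mpre _ (supp_measurable (pushforward P phi))) PS).
    exact: measurableT_comp mh mphi.
  move=> t St; apply: hc; apply/psdmx_qle; first exact: posmxP.
  exact: eS.
split=> //; rewrite /Rintegral (integral_pushforward mphi)//.
exact/measurable_EFinP.
Qed.

Lemma Pinfty_integrable n (mu : set (posop R n) -> \bar R) : Pinfty mu ->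
  exists (P : probability (posop R n) R) (e : R), [/\ mu = P, 0 < e, e < 1 &
  forall h : posop R n -> R, rcont h ->
    (exists c, forall A, qle e e^-1 (posmx A) -> `|h A| <= c) ->
    P.-integrable setT (EFin \o h)].
Proof.
move=> Pmu; have [[P mP] _ _] := Pmu; rewrite mP in Pmu *.
have [e [e0 e1 eh]] := @Pinfty_pushforward_integrable _ _ _ P id (@measurable_id _ _ _) Pmu.
by exists P, e; split=> // h ch /(eh _ ch)[].
Qed.

(** [mxintegral] is entrywise, so the real part of a trace against a constant matrix, a finite real
    combination of entries, passes through it. Matrix integral equations become scalar ones this
    way. *)
Lemma Rintegral_tr n (P : probability (posop R n) R) (C : 'M[R[i]]_n)
    (F : posop R n -> 'M[R[i]]_n) :
  (forall i j, P.-integrable setT (EFin \o (fun A => complex.Re (F A i j)))) ->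
  (forall i j, P.-integrable setT (EFin \o (fun A => complex.Im (F A i j)))) ->
  P.-integrable setT (EFin \o (fun A => complex.Re (\tr (C *m F A)))) /\
  Rintegral P setT (fun A => complex.Re (\tr (C *m F A))) =
  complex.Re (\tr (C *m mxintegral P F)).
Proof.
move=> IR II.
have ReE (G : 'M[R[i]]_n) : complex.Re (\tr (C *m G)) = \sum_i \sum_j
    (complex.Re (C i j) * complex.Re (G j i) - complex.Im (C i j) * complex.Im (G j i)).
  rewrite /mxtrace raddf_sum; apply: eq_bigr => i _.
  rewrite mxE raddf_sum; apply: eq_bigr => j _ /=.
  by case: (C i j) (G j i) => [a b] [c d].
rewrite ReE (funext (fun A => ReE (F A))).
have h1 i j : P.-integrable setT
    (EFin \o (fun A => complex.Re (C i j) * complex.Re (F A j i))).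
  exact: (integrableZl measurableT (complex.Re (C i j)) (IR j i)).
have h2 i j : P.-integrable setT
    (EFin \o (fun A => complex.Im (C i j) * complex.Im (F A j i))).
  exact: (integrableZl measurableT (complex.Im (C i j)) (II j i)).
have Iterm i j : P.-integrable setT (EFin \o (fun A =>
    complex.Re (C i j) * complex.Re (F A j i) - complex.Im (C i j) * complex.Im (F A j i))).
  exact: (integrableB measurableT (h1 i j) (h2 i j)).
have step i := Rintegral_sum (index_enum 'I_n) (Iterm i).
have [I1 ->] := Rintegral_sum (index_enum 'I_n) (fun i => (step i).1).
split=> //; apply: eq_bigr => i _; rewrite (step i).2; apply: eq_bigr => j _.
rewrite (RintegralB measurableT (h1 i j) (h2 i j)) !RintegralZl//.
by rewrite !mxE.
Qed.

End Supports.

(** * Positive operators in dimension one as positive reals *)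

Section DimensionOne.
Variable R : realType.
Implicit Types A B : posop R 1.

Lemma posop1E A : posmx A = (posop1_val A)%:C%:M.
Proof.
rewrite [LHS]mx11_scalar; congr (_%:M).
(* In dimension one the determinant is the entry itself, so its positivity makes the entry real. *)
have := posmx_det_gt0 (posmxP A); rewrite det_mx11 /posop1_val ltcE.
by case: (posmx A 0 0) => a b /andP[/eqP/= ->].
Qed.

Lemma posop1_gt0 A : 0 < posop1_val A.
Proof.
by have := posmx_det_gt0 (posmxP A); rewrite det_mx11 ltcE => /andP[].
Qed.

Lemma posop1_inj : injective (@posop1_val R).
Proof. by move=> A B AB; apply: val_inj; rewrite /= !posop1E AB. Qed.

Lemma posop1_scalar (x : R) (x0 : 0 < x) : posop1_val (posop_scalar 1 x0) = x.
Proof. by rewrite /posop1_val /= mxE eqxx mulr1n. Qed.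

Lemma posop1_detroot n (A : posop R n) : posop1_val (detroot_op A) = detroot A.
Proof. exact: posop1_scalar. Qed.

Lemma invmx_real_scalar (x : R) : x != 0 -> invmx (x%:C%:M : 'M[R[i]]_1) = (x^-1)%:C%:M.
Proof. by move=> x0; rewrite invmx_scalar; congr (_%:M); rewrite fmorphV. Qed.

Lemma mul_real_scalar (x y : R) : (x%:C%:M : 'M[R[i]]_1) *m y%:C%:M = (x * y)%:C%:M.
Proof. by rewrite -scalar_mxM; congr (_%:M); exact/esym/rmorphM. Qed.

Lemma posop1_opmean (sigma : opmean R) A B :
  posop1_val (opmean_app sigma A B) =
  posop1_val A * sigma (posop1_val B / posop1_val A).
Proof.
have a0 := posop1_gt0 A; have b0 := posop1_gt0 B.
have s0 : 0 < Num.sqrt (posop1_val A) by rewrite sqrtr_gt0.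
have sn : Num.sqrt (posop1_val A) != 0 by rewrite gt_eqF.
rewrite [LHS]/posop1_val /= /opmean_mx /mxsqrt (posop1E A) (mxfun1E _ a0).
rewrite (invmx_real_scalar sn) (posop1E B) !mul_real_scalar mxfun1E.
  rewrite !mul_real_scalar mxE eqxx mulr1n /=.
  have ss : Num.sqrt (posop1_val A) * Num.sqrt (posop1_val A) = posop1_val A.
    by rewrite -expr2 sqr_sqrtr ?ltW.
  rewrite mulrAC ss; congr (_ * sigma _).
  by rewrite mulrAC -invfM ss mulrC.
by rewrite !mulr_gt0 ?invr_gt0.
Qed.

Lemma rcont_val : rcont (@posop1_val R).
Proof. exact: mxcont_Re (@mxcont_id R 1). Qed.

Lemma quad_scalar n (a : R) (x : 'rV[R[i]]_n) : quad a%:C%:M x = a * frob x.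
Proof. by rewrite /quad dotmx_scalar. Qed.

Lemma qle_scalar n (c d a : R) : c <= a -> a <= d -> qle c d (a%:C%:M : 'M[R[i]]_n).
Proof. by move=> ca ad x; rewrite quad_scalar !ler_wpM2r ?frob_ge0. Qed.

Lemma qle_val c d A : qle c d A -> c <= posop1_val A /\ posop1_val A <= d.
Proof.
move=> /(_ (const_mx 1)); rewrite posop1E quad_scalar.
have -> : frob (const_mx 1 : 'M[R[i]]_(1, 1)) = 1.
  by rewrite /frob !big_ord1 mxE /nsq /= expr0n addr0 expr1n.
by rewrite !mulr1.
Qed.

Lemma val_qle c d A : c <= posop1_val A -> posop1_val A <= d -> qle c d A.
Proof. by move=> ? ?; rewrite posop1E; exact: qle_scalar. Qed.

Definition scale1 (c : R) (c0 : 0 < c) A : posop R 1 :=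
  posop_scalar 1 (mulr_gt0 c0 (posop1_gt0 A)).

Lemma val_scale1 c (c0 : 0 < c) A : posop1_val (scale1 c0 A) = c * posop1_val A.
Proof. exact: posop1_scalar. Qed.

Lemma scale1_pcont c (c0 : 0 < c) : pcont (scale1 c0).
Proof.
apply: (@mxcont_le _ _ _ _ (c ^+ 2) _ _ _ (@mxcont_id R 1)) => A B.
rewrite (posop1E A) (posop1E B) (posop1E (scale1 c0 A)) (posop1E (scale1 c0 B)).
rewrite !val_scale1 -!raddfB /frob !big_ord1 !mxE !mulr1n !nsqR.
by rewrite -mulrBr exprMn raddfB.
Qed.

End DimensionOne.

(** * Order bounds for scaling, determinant roots and operator means *)

Section Bounds.
Variable R : realType.

Lemma two_bounds (p q : R) : 0 < p -> 0 < q ->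
  exists e : R, [/\ 0 < e, e < 1, e <= p & q <= e^-1].
Proof.
move=> p0 q0.
have [|e [e0 e1 h]] := @pos_family_bounds R bool (fun b => if b then p else q).
  by case.
by exists e; split=> //; [exact: (h true).1|exact: (h false).2].
Qed.

Lemma Pinfty_scale1 (mu : set (posop R 1) -> \bar R) c (c0 : 0 < c) :
  Pinfty mu -> Pinfty (pushforward mu (scale1 c0)).
Proof.
apply: Pinfty_pushforward; first exact: scale1_pcont.
move=> e e0 e1; have [||e' [e'0 e'1 h1 h2]] := @two_bounds (c * e) (c / e).
- by rewrite mulr_gt0.
- by rewrite divr_gt0.
exists e'; split=> // A /qle_val[q1 q2]; apply: val_qle; rewrite val_scale1.
  by apply: (le_trans h1); rewrite ler_pM2l.
by apply: le_trans h2; rewrite ler_pM2l.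
Qed.

Lemma powR_root (x : R) n : (0 < n)%N -> 0 <= x -> (x ^+ n) `^ n%:R^-1 = x.
Proof.
move=> n0 x0; rewrite -powR_mulrn// -powRrM mulfV ?powRr1//.
by rewrite pnatr_eq0 -lt0n.
Qed.

Lemma powR_invl (x a : R) : 0 <= x -> x^-1 `^ a = (x `^ a)^-1.
Proof.
by move=> x0; rewrite -(powR_inv1 x0) -powRrM mulrC powRrM (powR_inv1 (powR_ge0 _ _)).
Qed.

Lemma Re_det n (A : posop R n) : complex.Re (\det A) = \prod_i eigr A i.
Proof. by rewrite (det_posmx (posmxP A)). Qed.

Lemma detroot_eigr n (A : posop R n) : detroot A = (\prod_i eigr A i) `^ n%:R^-1.
Proof. by rewrite /detroot Re_det. Qed.

Lemma detroot_bounds n (A : posop R n) (e : R) : (0 < n)%N -> 0 < e ->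
  qle e e^-1 A -> e <= detroot A /\ detroot A <= e^-1.
Proof.
move=> n0 e0 qA; rewrite detroot_eigr.
have eA i := eigr_qle i (posmxP A) qA; have A0 i := eigr_gt0 i (posmxP A).
have ei0 : 0 < e^-1 by rewrite invr_gt0.
have pe (x : R) : x ^+ n = \prod_(i < n) x by rewrite prodr_const card_ord.
split.
  rewrite -[leLHS](powR_root n0 (ltW e0)) ge0_ler_powR ?nnegrE ?invr_ge0 ?exprn_ge0 ?prodr_ge0 ?(ltW e0)//.
    by move=> i _; rewrite ltW.
  by rewrite pe ler_prod// => i _; rewrite ltW//= (eA i).1.
rewrite -[leRHS](powR_root n0 (ltW ei0)) ge0_ler_powR ?nnegrE ?invr_ge0 ?exprn_ge0 ?prodr_ge0 ?(ltW ei0)//.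
  by move=> i _; rewrite ltW.
by rewrite pe ler_prod// => i _; rewrite ltW//= (eA i).2.
Qed.

Lemma Pinfty_detroot n (mu : set (posop R n) -> \bar R) : (0 < n)%N ->
  Pinfty mu -> Pinfty (pushforward mu (@detroot_op R n)).
Proof.
move=> n0; apply: Pinfty_pushforward; first exact: detroot_op_pcont.
move=> e e0 e1; exists e; split=> // A qA; have [h1 h2] := detroot_bounds n0 e0 qA.
by apply: val_qle; rewrite posop1_detroot.
Qed.

Lemma Pinfty_opmean (sigma : opmean R) n (X : posop R n) mu :
  gcv sigma \/ gcc sigma -> Pinfty mu -> Pinfty (pushforward mu (opmean_app sigma X)).
Proof.
move=> gs; apply: Pinfty_pushforward; first exact: opmean_app_pcont.
move=> e e0 e1.
have pS := posmx_sqrt (posmxP X); have piS := posmx_inv pS.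
set S := mxsqrt X in pS piS.
have pX' : posmxb (invmx S *m invmx S).
  have := posmx_conj piS (posmx_scalar n (ltr01 : 0 < 1 :> R)).
  by rewrite mulmx1.
have [p [p0 p1 qX']] := posmx_qle_ex pX'.
have [q [q0 q1 qX]] := posmx_qle_ex (posmxP X).
(* Here p bounds the inverse of X and q bounds X: congruence by the inverse root scales the bounds
   of A by p, [sigma] is applied to the results, and congruence by the root scales them by q. *)
have [||e' [e'0 e'1 h1 h2]] := @two_bounds (sigma (e * p) * q) (sigma (e^-1 * p^-1) * q^-1).
- by rewrite mulr_gt0 ?repf_gt0 ?mulr_gt0.
- by rewrite mulr_gt0 ?repf_gt0 ?mulr_gt0 ?invr_gt0.
have ei0 : 0 < e^-1 by rewrite invr_gt0.
have pi0 : 0 < p^-1 by rewrite invr_gt0.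
exists e'; split=> // A qA; apply: (qleW h1 h2).
apply: (qle_conj (posmx_herm pS)).
- by rewrite ltW ?repf_gt0 ?mulr_gt0.
- by rewrite ltW ?repf_gt0 ?mulr_gt0.
- by rewrite (mxsqrtK (posmxP X)).
apply: qle_mxfun; [exact: posmx_conj piS (posmxP A)| |exact: mulr_gt0|exact: repf_nondecreasing].
by apply: (qle_conj (posmx_herm piS)) => //; exact: ltW.
Qed.

End Bounds.

Lemma mxsqrt_invK (R : realType) n (A : 'M[R[i]]_n) : posmxb A ->
  invmx (mxsqrt A) *m invmx (mxsqrt A) = invmx A.
Proof.
move=> pA; have uA := posmx_unit pA; have uS := posmx_unit (posmx_sqrt pA).
have AB : A *m (invmx (mxsqrt A) *m invmx (mxsqrt A)) = 1%:M.
  have : mxsqrt A *m mxsqrt A *m (invmx (mxsqrt A) *m invmx (mxsqrt A)) = 1%:M.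
    by rewrite -(mulmxA (mxsqrt A)) (mulKVmx uS) (mulmxV uS).
  by rewrite (mxsqrtK pA).
by rewrite -[LHS](mulKmx uA) AB mulmx1.
Qed.

(** * Determinant roots of congruences and operator means *)

Section Determinants.
Variables (R : realType) (N : nat).
Hypothesis N0 : (0 < N)%N.
Implicit Types (X A : posop R N).

Let cong X A := invmx (mxsqrt X) *m A *m invmx (mxsqrt X).

Lemma posmx_cong X A : posmxb (cong X A).
Proof. exact: posmx_conj (posmx_inv (posmx_sqrt (posmxP X))) (posmxP A). Qed.

(** The determinant is multiplicative, so congruence by the inverse root of X divides it by det
    X. *)
Lemma prod_eigr_cong X A :
  (\prod_i eigr (cong X A) i) `^ N%:R^-1 = detroot A / detroot X.
Proof.
have dX : 0 < complex.Re (\det X) by rewrite Re_det prodr_gt0// => i _; exact: eigr_gt0 (posmxP X).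
have dA : 0 <= complex.Re (\det A).
  by rewrite Re_det prodr_ge0// => i _; apply: ltW; exact: eigr_gt0 (posmxP A).
have : (\prod_i eigr (cong X A) i)%:C = (complex.Re (\det A) / complex.Re (\det X))%:C.
  rewrite -(det_posmx (posmx_cong X A)) /cong !det_mulmx mulrAC -det_mulmx.
  rewrite (mxsqrt_invK (posmxP X)) det_inv mulrC.
  by rewrite (det_posmx (posmxP X)) (det_posmx (posmxP A)) /= rmorphM fmorphV.
move=> /complexI ->; rewrite powRM ?invr_ge0 ?(ltW dX)// /detroot; congr (_ * _).
by rewrite powR_invl ?ltW.
Qed.

Lemma detroot_opmean (sigma : opmean R) X A :
  detroot (opmean_app sigma X A) =
  detroot X * (\prod_i sigma (eigr (cong X A) i)) `^ N%:R^-1.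
Proof.
have dX : 0 <= complex.Re (\det X).
  by rewrite Re_det prodr_ge0// => i _; apply: ltW; exact: eigr_gt0 (posmxP X).
rewrite -powRM//; last first.
  by rewrite prodr_ge0// => i _; rewrite ltW ?repf_gt0 ?(eigr_gt0 _ (posmx_cong X A)).
congr (_ `^ _).
have -> : \det (opmean_app sigma X A) =
    \det X * (\prod_i sigma (eigr (cong X A) i))%:C.
  rewrite /= /opmean_mx 2!det_mulmx mulrAC -(det_mulmx (mxsqrt X)).
  by rewrite (mxsqrtK (posmxP X)) (det_mxfun sigma).
by rewrite (det_posmx (posmxP X)) -rmorphM.
Qed.

(** After the common factor d(X) is removed, this is the n-point geometric convexity at the
    eigenvalues of the congruence, whose geometric mean is d(A)/d(X). *)
Lemma gcv_detroot_opmean (sigma : opmean R) X A : gcv sigma ->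
  posop1_val (opmean_app sigma (detroot_op X) (detroot_op A))
  <= detroot (opmean_app sigma X A).
Proof.
move=> gs; rewrite posop1_opmean !posop1_detroot detroot_opmean -prod_eigr_cong.
rewrite ler_pM2l ?detroot_gt0//; apply: gcv_geometric_mean => // i.
exact: eigr_gt0 (posmx_cong X A).
Qed.

Lemma gcc_detroot_opmean (sigma : opmean R) X A : gcc sigma ->
  detroot (opmean_app sigma X A)
  <= posop1_val (opmean_app sigma (detroot_op X) (detroot_op A)).
Proof.
move=> gs; rewrite posop1_opmean !posop1_detroot detroot_opmean -prod_eigr_cong.
rewrite ler_pM2l ?detroot_gt0//; apply: gcc_geometric_mean => // i.
exact: eigr_gt0 (posmx_cong X A).
Qed.

(** AM-GM for the eigenvalues of the congruence, whose trace is that of [invmx X *m A] by cyclicity.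
    The bound is linear in A and attained at A = X: it is the supporting hyperplane of the concave
    function d at X. *)
Lemma detroot_le_tr X A :
  detroot A <= detroot X / N%:R * complex.Re (\tr (invmx X *m A)).
Proof.
have trE : complex.Re (\tr (invmx X *m A)) = \sum_i eigr (cong X A) i.
  rewrite -[RHS]/(complex.Re (\sum_i eigr (cong X A) i)%:C).
  rewrite -(tr_posmx (posmx_cong X A)) /cong [in RHS]mxtrace_mulC mulmxA.
  by rewrite (mxsqrt_invK (posmxP X)).
rewrite trE mulrAC -mulrA -ler_pdivrMl ?detroot_gt0// mulrC -prod_eigr_cong.
have e0 i : 0 < eigr (cong X A) i := eigr_gt0 i (posmx_cong X A).
have N0' : 0 < N%:R :> R by rewrite ltr0n.
rewrite -[leRHS](powR_root N0); last first.
  by rewrite divr_ge0 ?sumr_ge0 ?ltW// => i _; rewrite ltW.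
rewrite ge0_ler_powR ?nnegrE ?invr_ge0 ?exprn_ge0 ?divr_ge0 ?sumr_ge0 ?prodr_ge0 ?(ltW N0')//.
- by move=> i _; rewrite ltW.
- by move=> i _; rewrite ltW.
have [+ _] := leif_AGM (A := predT) (E := eigr (cong X A)) (fun i _ => ltW (e0 i)).
by rewrite cardT size_enum_ord.
Qed.

Lemma detroot_inv X (Y : posop R N) : posmx Y = invmx X -> detroot Y = (detroot X)^-1.
Proof.
move=> YE; have dX : 0 < complex.Re (\det X) by rewrite Re_det prodr_gt0// => i _; exact: eigr_gt0 (posmxP X).
have E : complex.Re (\det Y) = (complex.Re (\det X))^-1.
  by rewrite YE det_inv (det_posmx (posmxP X)) -fmorphV.
by rewrite /detroot E powR_invl ?ltW.
Qed.

End Determinants.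

(** * Integrability of scalar functions and of matrix entries *)

Section Integrability.
Variable R : realType.

Lemma val_integrable d (T : measurableType d) (P : probability T R)
    (phi : T -> posop R 1) (h : R -> R) :
  (forall t, 0 < t -> {for t, continuous h}) ->
  (forall e : R, 0 < e -> e < 1 -> exists c, forall a, e <= a -> a <= e^-1 -> `|h a| <= c) ->
  measurable_fun setT phi -> Pinfty (pushforward P phi) ->
  P.-integrable setT (EFin \o (fun t => h (posop1_val (phi t)))) /\
  fine (\int[pushforward P phi]_A (h (posop1_val A))%:E) =
  Rintegral P setT (fun t => h (posop1_val (phi t))).
Proof.
move=> ch bh mphi Pphi.
have [e [e0 e1 H]] := Pinfty_pushforward_integrable mphi Pphi.
apply: (H (fun A => h (posop1_val A))).
  by move=> A; exact: (continuous_cvg _ (ch _ (posop1_gt0 A)) (@rcont_val R A)).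
have [c hc] := bh e e0 e1; exists c => A /qle_val[? ?].
exact: hc.
Qed.

Lemma id_bounded (e : R) : 0 < e -> e < 1 ->
  exists c, forall a : R, e <= a -> a <= e^-1 -> `|a| <= c.
Proof.
move=> e0 e1; exists e^-1 => a ea ae; rewrite ger0_norm//.
exact: le_trans (ltW e0) ea.
Qed.

Lemma inv_bounded (e : R) : 0 < e -> e < 1 ->
  exists c, forall a : R, e <= a -> a <= e^-1 -> `|a^-1| <= c.
Proof.
move=> e0 e1; exists e^-1 => a ea ae; have a0 := lt_le_trans e0 ea.
by rewrite ger0_norm ?invr_ge0 ?(ltW a0)// lef_pV2.
Qed.

Lemma ln_bounded (c d : R) : 0 < c ->
  exists k, forall a : R, c <= a -> a <= d -> `|ln a| <= k.
Proof.
move=> c0; exists (`|ln c| + `|ln d|) => a ca ad; have a0 := lt_le_trans c0 ca.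
have d0 := lt_le_trans a0 ad.
have h1 : ln c <= ln a by rewrite ler_ln.
have h2 : ln a <= ln d by rewrite ler_ln.
have := ler_norm (ln d); have := ler_norm (- ln c); rewrite normrN.
have := normr_ge0 (ln d); have := normr_ge0 (ln c).
by move=> *; rewrite ler_norml; apply/andP; split; lra.
Qed.

Lemma ln_bounded_inv (e : R) : 0 < e -> e < 1 ->
  exists c, forall a : R, e <= a -> a <= e^-1 -> `|ln a| <= c.
Proof. by move=> e0 _; exact: ln_bounded. Qed.

Lemma ln_cont (t : R) : 0 < t -> {for t, continuous (@ln R)}.
Proof. exact: continuous_ln. Qed.

Lemma inv_cont (t : R) : 0 < t -> {for t, continuous (@GRing.inv R)}.
Proof. by move=> t0; apply: inv_continuous; rewrite gt_eqF. Qed.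

Lemma id_cont (t : R) : 0 < t -> {for t, continuous (@idfun R)}.
Proof. by move=> _; apply: cvg_id. Qed.

(** K + 1 dominates the square root of K for every K >= 0. *)
Lemma normr_le_nsq (z : R[i]) (K : R) : nsq z <= K ->
  `|complex.Re z| <= K + 1 /\ `|complex.Im z| <= K + 1.
Proof.
move=> zK; have K0 : 0 <= K := le_trans (nsq_ge0 z) zK.
have h (t : R) : t ^+ 2 <= K -> `|t| <= K + 1.
  by rewrite -(real_normK (num_real t)) expr2 => tK; have := normr_ge0 t; nra.
move: zK; rewrite /nsq => zK; have := sqr_ge0 (complex.Re z).
by have := sqr_ge0 (complex.Im z) => ? ?; split; apply: h; lra.
Qed.

Lemma entries_integrable n (P : probability (posop R n) R) (e : R)
    (F : posop R n -> 'M[R[i]]_n) (K : R) :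
  (forall h : posop R n -> R, rcont h ->
    (exists c, forall A, qle e e^-1 (posmx A) -> `|h A| <= c) ->
    P.-integrable setT (EFin \o h)) ->
  mxcont F -> (forall A, qle e e^-1 (posmx A) -> forall i j, nsq (F A i j) <= K) ->
  (forall i j, P.-integrable setT (EFin \o (fun A => complex.Re (F A i j)))) /\
  (forall i j, P.-integrable setT (EFin \o (fun A => complex.Im (F A i j)))).
Proof.
move=> H cF bF; split=> i j; apply: H.
- exact: mxcont_Re.
- by exists (K + 1) => A /bF/(_ i j)/normr_le_nsq[].
- exact: mxcont_Im.
- by exists (K + 1) => A /bF/(_ i j)/normr_le_nsq[].
Qed.

Lemma posop_entry_le n (A : posop R n) (e : R) i j : 0 < e -> qle e e^-1 A ->
  nsq (posmx A i j) <= n%:R * e^-1 ^+ 2.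
Proof.
move=> e0 qA; rewrite (posmx_mxfun_id (posmxP A)).
apply: mxfun_entry_le => k; have [h1 h2] := eigr_qle k (posmxP A) qA.
by rewrite ger0_norm// (le_trans (ltW e0)).
Qed.

Lemma posop_inv_entry_le n (A : posop R n) (e : R) i j : 0 < e -> qle e e^-1 A ->
  nsq (invmx A i j) <= n%:R * e^-1 ^+ 2.
Proof.
move=> e0 qA; rewrite (posmx_invE (posmxP A)).
apply: mxfun_entry_le => k; have [h1 h2] := eigr_qle k (posmxP A) qA.
have k0 := lt_le_trans e0 h1.
by rewrite ger0_norm ?invr_ge0 ?(ltW k0)// lef_pV2.
Qed.

Lemma mxcont_inv n : mxcont (fun A : posop R n => invmx A).
Proof.
have -> : (fun A : posop R n => invmx A) = (fun A => mxfun GRing.inv (posmx A)).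
  by apply/funext => A; rewrite (posmx_invE (posmxP A)).
apply: mxcont_mxfun; [exact: mxcont_id|exact: posmxP|exact: inv_cont].
Qed.

Lemma mxlog_cong_mxcont n (X : posop R n) :
  mxcont (fun A : posop R n => mxlog (invmx (mxsqrt X) *m A *m invmx (mxsqrt X))).
Proof.
apply: mxcont_mxfun.
- by apply: mxcont_conj; exact: mxcont_id.
- exact: posmx_cong.
- exact: ln_cont.
Qed.

Lemma mxlog_cong_entry_le n (X : posop R n) (e : R) : 0 < e -> exists K,
  forall A : posop R n, qle e e^-1 A -> forall i j,
  nsq (mxlog (invmx (mxsqrt X) *m A *m invmx (mxsqrt X)) i j) <= K.
Proof.
move=> e0; have piS := posmx_inv (posmx_sqrt (posmxP X)).
have pX' : posmxb (invmx (mxsqrt X) *m invmx (mxsqrt X)).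
  by rewrite (mxsqrt_invK (posmxP X)); exact: posmx_inv (posmxP X).
have [p [p0 p1 qX']] := posmx_qle_ex pX'.
have [c hc] := @ln_bounded (e * p) (e^-1 * p^-1) (mulr_gt0 e0 p0).
exists (n%:R * c ^+ 2) => A qA i j; apply: mxfun_entry_le => k.
have ei0 : 0 < e^-1 by rewrite invr_gt0.
have [h1 h2] := eigr_qle k (posmx_cong X A)
  (qle_conj (posmx_herm piS) (ltW e0) (ltW ei0) qX' qA).
exact: hc.
Qed.

End Integrability.

(** * The base means in dimension one: formulas, monotonicity, homogeneity *)

Section BaseMeans.
Variable R : realType.
Implicit Types M : mean R.

Section Scalar.
Context d (T : measurableType d) (P : probability T R) (phi : T -> posop R 1).
Hypotheses (mphi : measurable_fun setT phi) (Pphi : Pinfty (pushforward P phi)).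

Lemma arithmetic1E M : is_arithmetic M ->
  posop1_val (M 1%N (pushforward P phi)) = Rintegral P setT (fun t => posop1_val (phi t)).
Proof.
move=> aM; have [_ <-] := val_integrable (@id_cont R) (@id_bounded R) mphi Pphi.
by rewrite /posop1_val aM// mxE.
Qed.

Lemma harmonic1E M : is_harmonic M ->
  (posop1_val (M 1%N (pushforward P phi)))^-1 =
  Rintegral P setT (fun t => (posop1_val (phi t))^-1).
Proof.
move=> hM; have [_ <-] := val_integrable (@inv_cont R) (@inv_bounded R) mphi Pphi.
have vi (A : posop R 1) : complex.Re (invmx A 0 0) = (posop1_val A)^-1.
  by rewrite posop1E invmx_real_scalar ?gt_eqF ?posop1_gt0// mxE eqxx mulr1n.
rewrite -vi hM// invmxK mxE /=; congr (fine (integral _ _ _)).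
by apply/funext => A; rewrite vi.
Qed.

(** For scalars the congruence is the quotient A/X, so the Karcher equation says that ln A - ln X
    integrates to zero: the geometric mean. *)
Lemma karcher1E M : is_karcher M ->
  ln (posop1_val (M 1%N (pushforward P phi))) =
  Rintegral P setT (fun t => ln (posop1_val (phi t))).
Proof.
move=> kM; have [+ _] := kM _ _ Pphi; set X := M _ _.
have x0 := posop1_gt0 X.
have lnE (A : posop R 1) : complex.Re (mxlog (invmx (mxsqrt X) *m A *m invmx (mxsqrt X)) 0 0)
    = ln (posop1_val A) - ln (posop1_val X).
  have s0 : 0 < Num.sqrt (posop1_val X) by rewrite sqrtr_gt0.
  have sn : Num.sqrt (posop1_val X) != 0 by rewrite gt_eqF.
  rewrite /mxsqrt (posop1E X) (mxfun1E _ x0) (invmx_real_scalar sn) (posop1E A).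
  rewrite !mul_real_scalar /mxlog mxfun1E ?mulr_gt0 ?invr_gt0 ?posop1_gt0//.
  rewrite mxE eqxx mulr1n /= -lnV ?posrE// -lnM ?posrE ?invr_gt0 ?posop1_gt0//.
  have ss : Num.sqrt (posop1_val X) * Num.sqrt (posop1_val X) = posop1_val X.
    by rewrite -expr2 sqr_sqrtr ?ltW.
  by rewrite mulrAC -invfM ss mulrC.
move=> /matrixP/(_ 0 0)/(congr1 (@complex.Re R)); rewrite !mxE /=.
under eq_integral do rewrite lnE.
have [I1 _] := val_integrable (@ln_cont R) (@ln_bounded_inv R) mphi Pphi.
have [||_ ->] := @val_integrable _ _ _ P phi (fun t => ln t - ln (posop1_val X)) _ _ mphi Pphi.
- by move=> t t0; apply: cvgB; [exact: ln_cont|exact: cvg_cst].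
- move=> e e0 e1; have [c hc] := ln_bounded_inv e0 e1.
  exists (c + `|ln (posop1_val X)|) => a ea ae.
  by apply: le_trans (ler_normB _ _) _; rewrite lerD2r hc.
have Icst : P.-integrable setT (EFin \o cst (ln (posop1_val X))).
  exact: finite_measure_integrable_cst.
rewrite (RintegralB measurableT I1 Icst) Rintegral_cst//.
have -> : fine (P setT) = 1 by rewrite probability_setT.
by rewrite mulr1 => /eqP; rewrite subr_eq0 => /eqP.
Qed.

End Scalar.

Definition homog1 M := forall (mu : set (posop R 1) -> \bar R) (c : R) (c0 : 0 < c),
  Pinfty mu ->
  posop1_val (M 1%N (pushforward mu (scale1 c0))) = c * posop1_val (M 1%N mu).

(* Monotonicity for the usual stochastic order, phrased with a coupling. *)
Definition mono1 M := forall d (T : measurableType d) (P : probability T R)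
  (phi psi : T -> posop R 1),
  measurable_fun setT phi -> measurable_fun setT psi ->
  Pinfty (pushforward P phi) -> Pinfty (pushforward P psi) ->
  (forall t, posop1_val (phi t) <= posop1_val (psi t)) ->
  posop1_val (M 1%N (pushforward P phi)) <= posop1_val (M 1%N (pushforward P psi)).

Lemma arithmetic_mono1 M : is_arithmetic M -> mono1 M.
Proof.
move=> aM d T P phi psi mphi mpsi Pphi Ppsi le; rewrite !arithmetic1E//.
have [I1 _] := val_integrable (@id_cont R) (@id_bounded R) mphi Pphi.
have [I2 _] := val_integrable (@id_cont R) (@id_bounded R) mpsi Ppsi.
exact: le_Rintegral.
Qed.

Lemma harmonic_mono1 M : is_harmonic M -> mono1 M.
Proof.
move=> hM d T P phi psi mphi mpsi Pphi Ppsi le.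
rewrite -lef_pV2 ?posrE ?posop1_gt0// !harmonic1E//.
have [I1 _] := val_integrable (@inv_cont R) (@inv_bounded R) mphi Pphi.
have [I2 _] := val_integrable (@inv_cont R) (@inv_bounded R) mpsi Ppsi.
by apply: le_Rintegral => // t _; rewrite lef_pV2 ?posrE ?posop1_gt0.
Qed.

Lemma karcher_mono1 M : is_karcher M -> mono1 M.
Proof.
move=> kM d T P phi psi mphi mpsi Pphi Ppsi le.
rewrite -ler_ln ?posrE ?posop1_gt0// !karcher1E//.
have [I1 _] := val_integrable (@ln_cont R) (@ln_bounded_inv R) mphi Pphi.
have [I2 _] := val_integrable (@ln_cont R) (@ln_bounded_inv R) mpsi Ppsi.
by apply: le_Rintegral => // t _; rewrite ler_ln ?posrE ?posop1_gt0.
Qed.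

Lemma Pinfty_prob n (mu : set (posop R n) -> \bar R) : Pinfty mu ->
  exists P : probability (posop R n) R, mu = P.
Proof. by case. Qed.

Lemma arithmetic_homog1 M : is_arithmetic M -> homog1 M.
Proof.
move=> aM mu c c0 Pmu; have [P mP] := Pinfty_prob Pmu; rewrite mP in Pmu *.
have mid := @measurable_id _ (posop R 1) setT.
rewrite (arithmetic1E (pcont_measurable (scale1_pcont c0)) (Pinfty_scale1 c0 Pmu) aM).
rewrite (arithmetic1E (phi := id) mid Pmu aM).
have [I1 _] := val_integrable (phi := id) (@id_cont R) (@id_bounded R) mid Pmu.
rewrite -(RintegralZl c measurableT I1).
by apply: eq_Rintegral => A _; rewrite val_scale1.
Qed.

Lemma harmonic_homog1 M : is_harmonic M -> homog1 M.
Proof.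
move=> hM mu c c0 Pmu; have [P mP] := Pinfty_prob Pmu; rewrite mP in Pmu *.
have mid := @measurable_id _ (posop R 1) setT.
apply: invr_inj.
rewrite (harmonic1E (pcont_measurable (scale1_pcont c0)) (Pinfty_scale1 c0 Pmu) hM).
rewrite invfM (harmonic1E (phi := id) mid Pmu hM).
have [I1 _] := val_integrable (phi := id) (@inv_cont R) (@inv_bounded R) mid Pmu.
rewrite -(RintegralZl c^-1 measurableT I1).
by apply: eq_Rintegral => A _; rewrite val_scale1 invfM.
Qed.

Lemma karcher_homog1 M : is_karcher M -> homog1 M.
Proof.
move=> kM mu c c0 Pmu; have [P mP] := Pinfty_prob Pmu; rewrite mP in Pmu *.
have mid := @measurable_id _ (posop R 1) setT.
apply: ln_inj; rewrite ?posrE ?mulr_gt0 ?posop1_gt0//.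
rewrite (karcher1E (pcont_measurable (scale1_pcont c0)) (Pinfty_scale1 c0 Pmu) kM).
rewrite lnM ?posrE ?posop1_gt0// (karcher1E (phi := id) mid Pmu kM).
have [I1 _] := val_integrable (phi := id) (@ln_cont R) (@ln_bounded_inv R) mid Pmu.
have Icst : P.-integrable setT (EFin \o cst (ln c)).
  exact: finite_measure_integrable_cst.
have -> : ln c = Rintegral P setT (cst (ln c)).
  rewrite Rintegral_cst//.
  have -> : fine (P setT) = 1 by rewrite probability_setT.
  by rewrite mulr1.
rewrite -(RintegralD measurableT Icst I1).
by apply: eq_Rintegral => A _; rewrite val_scale1 lnM ?posrE ?posop1_gt0.
Qed.

End BaseMeans.

(** * Deformation and composition in dimension one *)

Section Deformation.
Variable R : realType.
Implicit Types (M : mean R) (sigma : opmean R).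

(* By homogeneity y |-> M(y s nu) / y is nonincreasing. *)
Lemma opmean_ratio_mono M sigma (nu : set (posop R 1) -> \bar R) (y z : posop R 1) :
  homog1 M -> mono1 M -> gcv sigma \/ gcc sigma -> Pinfty nu ->
  posop1_val y <= posop1_val z ->
  posop1_val y * posop1_val (M 1%N (pushforward nu (opmean_app sigma z))) <=
  posop1_val z * posop1_val (M 1%N (pushforward nu (opmean_app sigma y))).
Proof.
move=> hM mM gs Pnu yz; have y0 := posop1_gt0 y; have z0 := posop1_gt0 z.
have c0 : 0 < posop1_val y / posop1_val z by rewrite divr_gt0.
have Pz := Pinfty_opmean z gs Pnu; have Py := Pinfty_opmean y gs Pnu.
suff : posop1_val y / posop1_val z * posop1_val (M 1%N (pushforward nu (opmean_app sigma z)))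
    <= posop1_val (M 1%N (pushforward nu (opmean_app sigma y))).
  by rewrite mulrAC ler_pdivrMr// [X in _ <= X]mulrC.
rewrite -(hM _ _ c0 Pz).
have := Pinfty_scale1 c0 Pz; have [P mP] := Pinfty_prob Pnu; rewrite mP in Pz Py *.
move=> Pcz; apply: (mM _ _ P (scale1 c0 \o opmean_app sigma z)) => //.
- apply: measurableT_comp; first exact: pcont_measurable (scale1_pcont c0).
  exact: pcont_measurable (opmean_app_pcont z gs).
- exact: pcont_measurable (opmean_app_pcont y gs).
(* For a single a the claim is (y/z) z f(a/z) = y f(a/z) <= y f(a/y), as f is nondecreasing and y <=
   z. *)
move=> A; rewrite /= val_scale1 !posop1_opmean mulrA divfK ?gt_eqF//.
rewrite ler_pM2l// repf_nondecreasing ?divr_gt0 ?posop1_gt0//.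
by rewrite ler_pM2l ?posop1_gt0// lef_pV2.
Qed.

(** If y were below the fixed point x, monotonicity of the ratio would give y <= M(y sigma nu).
    Together with the hypothesis y would be a second fixed point. *)
Lemma deformation_le M sigma M' (nu : set (posop R 1) -> \bar R) (y : posop R 1) :
  homog1 M -> mono1 M -> gcv sigma \/ gcc sigma -> is_deformation M sigma M' ->
  Pinfty nu -> posop1_val (M 1%N (pushforward nu (opmean_app sigma y))) <= posop1_val y ->
  posop1_val (M' 1%N nu) <= posop1_val y.
Proof.
move=> hM mM gs dM Pnu yM; have [+ uniq] := dM _ _ Pnu; set x := M' _ _ in uniq *.
move=> xE; rewrite leNgt; apply/negP => yx; have x0 := posop1_gt0 x.
have := opmean_ratio_mono hM mM gs Pnu (ltW yx); rewrite -xE mulrC ler_pM2l// => My.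
have yE : y = M 1%N (pushforward nu (opmean_app sigma y)).
  by apply: posop1_inj; apply/eqP; rewrite eq_le My yM.
by move: yx; rewrite (uniq y yE) ltxx.
Qed.

Lemma deformation_ge M sigma M' (nu : set (posop R 1) -> \bar R) (y : posop R 1) :
  homog1 M -> mono1 M -> gcv sigma \/ gcc sigma -> is_deformation M sigma M' ->
  Pinfty nu -> posop1_val y <= posop1_val (M 1%N (pushforward nu (opmean_app sigma y))) ->
  posop1_val y <= posop1_val (M' 1%N nu).
Proof.
move=> hM mM gs dM Pnu yM; have [+ uniq] := dM _ _ Pnu; set x := M' _ _ in uniq *.
move=> xE; rewrite leNgt; apply/negP => xy; have x0 := posop1_gt0 x.
have := opmean_ratio_mono hM mM gs Pnu (ltW xy); rewrite -xE [leRHS]mulrC ler_pM2l// => My.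
have yE : y = M 1%N (pushforward nu (opmean_app sigma y)).
  by apply: posop1_inj; apply/eqP; rewrite eq_le My yM.
by move: xy; rewrite (uniq y yE) ltxx.
Qed.

(** Since (c x) sigma (c A) = c (x sigma A), the point c x solves the equation of the scaled
    measure, and uniqueness identifies it. *)
Lemma deformation_homog1 M sigma M' : homog1 M -> gcv sigma \/ gcc sigma ->
  is_deformation M sigma M' -> homog1 M'.
Proof.
move=> hM gs dM mu c c0 Pmu; have [+ _] := dM _ _ Pmu; set x := M' _ _ => xE.
have [_ uniq] := dM _ _ (Pinfty_scale1 c0 Pmu).
rewrite (uniq (scale1 c0 x)) ?val_scale1//; apply: posop1_inj.
have -> : pushforward (pushforward mu (scale1 c0)) (opmean_app sigma (scale1 c0 x)) =
    pushforward (pushforward mu (opmean_app sigma x)) (scale1 c0).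
  apply/funext => U; rewrite /pushforward; congr mu.
  have E A : opmean_app sigma (scale1 c0 x) (scale1 c0 A) = scale1 c0 (opmean_app sigma x A).
    apply: posop1_inj; rewrite posop1_opmean !val_scale1 posop1_opmean mulrA.
    by rewrite -mulf_div divff ?gt_eqF// mul1r.
  by apply/funext => A; rewrite /preimage /= E.
by rewrite hM ?val_scale1 -?xE//; exact: Pinfty_opmean.
Qed.

(** The fixed point y of the larger measure satisfies M(y sigma phi) <= y by monotonicity of M and
    of f, so the comparison principle puts the smaller fixed point below it. *)
Lemma deformation_mono1 M sigma M' : homog1 M -> mono1 M ->
  gcv sigma \/ gcc sigma -> is_deformation M sigma M' -> mono1 M'.
Proof.
move=> hM mM gs dM d T P phi psi mphi mpsi Pphi Ppsi le.
apply: (deformation_le hM mM gs dM Pphi).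
have [+ _] := dM _ _ Ppsi; set y := M' _ _ => yE; rewrite [in leRHS]yE.
have mo := pcont_measurable (opmean_app_pcont y gs).
apply: (mM _ _ P (opmean_app sigma y \o phi) (opmean_app sigma y \o psi)).
- exact: measurableT_comp mo mphi.
- exact: measurableT_comp mo mpsi.
- exact: Pinfty_opmean Pphi.
- exact: Pinfty_opmean Ppsi.
move=> t; rewrite /= !posop1_opmean ler_pM2l ?posop1_gt0//.
by rewrite repf_nondecreasing ?divr_gt0 ?posop1_gt0// ler_pM2r ?invr_gt0 ?posop1_gt0.
Qed.

Lemma dirac_sum_preimage n m1 m2 (w : 'I_n -> R) (a : 'I_n -> posop R m1)
    (phi : posop R m1 -> posop R m2) :
  pushforward (fun U => \sum_(j < n) (w j)%:E * \d_(a j) U)%E phi =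
  (fun U => \sum_(j < n) (w j)%:E * \d_(phi (a j)) U)%E.
Proof.
apply/funext => U; rewrite /pushforward; apply: eq_bigr => j _.
by rewrite !diracE; congr (_ * (_%:R)%:E)%E; congr nat_of_bool; apply/idP/idP; rewrite !inE.
Qed.

Lemma dirac_sum_mono1 M n (w : 'I_n -> R) (a b : 'I_n -> posop R 1) : mono1 M ->
  (forall j, 0 <= w j) -> \sum_j w j = 1 ->
  (forall j, posop1_val (a j) <= posop1_val (b j)) ->
  posop1_val (M 1%N (fun U => \sum_(j < n) (w j)%:E * \d_(a j) U)%E) <=
  posop1_val (M 1%N (fun U => \sum_(j < n) (w j)%:E * \d_(b j) U)%E).
Proof.
move=> mM w0 w1 ab; have [P PE] := discrete_probability w0 w1.
have Pa := Pinfty_dirac_sum a w0 w1; have Pb := Pinfty_dirac_sum b w0 w1.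
rewrite (dirac_sum_pushforward a PE) in Pa *; rewrite (dirac_sum_pushforward b PE) in Pb *.
apply: mM => //; try by move=> _ Y _.
(* Outside the index range both families take the value [point], where the comparison is an
   equality. *)
by move=> k; case: insub.
Qed.

Lemma composition_homog1 n (w : 'I_n -> R) M0 (Ms : 'I_n -> mean R) M' :
  (forall j, 0 <= w j) -> \sum_j w j = 1 -> homog1 M0 ->
  (forall j, homog1 (Ms j)) -> is_composition w M0 Ms M' -> homog1 M'.
Proof.
move=> w0 w1 h0 hs cM mu c c0 Pmu.
rewrite (cM _ _ Pmu) (cM _ _ (Pinfty_scale1 c0 Pmu)) -h0.
  rewrite dirac_sum_preimage; congr (posop1_val (M0 _ _)).
  have E j : Ms j 1%N (pushforward mu (scale1 c0)) = scale1 c0 (Ms j 1%N mu).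
    by apply: posop1_inj; rewrite hs// val_scale1.
  by apply/funext => U; apply: eq_bigr => j _; rewrite E.
exact: Pinfty_dirac_sum.
Qed.

Lemma composition_mono1 n (w : 'I_n -> R) M0 (Ms : 'I_n -> mean R) M' :
  (forall j, 0 <= w j) -> \sum_j w j = 1 -> mono1 M0 ->
  (forall j, mono1 (Ms j)) -> is_composition w M0 Ms M' -> mono1 M'.
Proof.
move=> w0 w1 m0 ms cM d T P phi psi mphi mpsi Pphi Ppsi le.
rewrite (cM _ _ Pphi) (cM _ _ Ppsi); apply: dirac_sum_mono1 => // j.
exact: ms.
Qed.

(** The two properties go through one induction because monotonicity of a deformation also uses
    homogeneity of the mean being deformed. *)
Lemma derived_homog1_mono1 (base : mean R -> Prop) (adm : opmean R -> Prop) M :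
  (forall M, base M -> [\/ is_arithmetic M, is_harmonic M | is_karcher M]) ->
  (forall sigma, adm sigma -> gcv sigma \/ gcc sigma) ->
  derived base adm M -> homog1 M /\ mono1 M.
Proof.
move=> hb ha; elim=> {M} [M /hb|M sigma M' _ [hM mM] /ha gs _ dM|].
- by case=> bM; split; [exact: arithmetic_homog1|exact: arithmetic_mono1
    |exact: harmonic_homog1|exact: harmonic_mono1|exact: karcher_homog1|exact: karcher_mono1].
- by split; [exact: deformation_homog1 dM|exact: deformation_mono1 dM].
move=> n w M0 Ms M' w0 w1 _ [h0 m0] _ hms cM; split.
- by apply: composition_homog1 cM => // j; have [] := hms j.
- by apply: composition_mono1 cM => // j; have [] := hms j.
Qed.

End Deformation.

(** * The determinant inequality for the base means and its preservation *)

Section Main.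
Variables (R : realType) (N : nat).
Hypothesis N0 : (0 < N)%N.
Implicit Types (M : mean R) (mu : set (posop R N) -> \bar R).

(* The tangent inequality [detroot_le_tr] at the barycentre, integrated. *)
Lemma detroot_jensen (P : probability (posop R N) R) (F : posop R N -> posop R N)
    (X : posop R N) :
  (forall i j, P.-integrable setT (EFin \o (fun A => complex.Re (posmx (F A) i j)))) ->
  (forall i j, P.-integrable setT (EFin \o (fun A => complex.Im (posmx (F A) i j)))) ->
  P.-integrable setT (EFin \o (fun A => detroot (F A))) ->
  posmx X = mxintegral P (fun A => posmx (F A)) ->
  Rintegral P setT (fun A => detroot (F A)) <= detroot X.
Proof.
move=> IR II Id XE; have [It tE] := Rintegral_tr (invmx X) IR II.
have Nn : N%:R != 0 :> R by rewrite pnatr_eq0 -lt0n.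
have -> : detroot X = Rintegral P setT (fun A =>
    detroot X / N%:R * complex.Re (\tr (invmx X *m F A))).
  rewrite (RintegralZl _ measurableT It) tE -XE mulVmx ?(posmx_unit (posmxP X))//.
  by rewrite mxtrace1 -[X in complex.Re X]/(N%:R : R[i]) -(rmorph_nat (@real_complex R)) /= divfK.
apply: le_Rintegral => //.
  exact: (integrableZl measurableT (detroot X / N%:R) It).
by move=> A _; exact: detroot_le_tr.
Qed.

Lemma detroot_integrable mu (P : probability (posop R N) R) (h : R -> R) :
  mu = P -> Pinfty mu -> (forall t, 0 < t -> {for t, continuous h}) ->
  (forall e : R, 0 < e -> e < 1 -> exists c, forall a, e <= a -> a <= e^-1 -> `|h a| <= c) ->
  P.-integrable setT (EFin \o (fun A => h (detroot A))).
Proof.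
move=> -> Pmu ch bh.
have [+ _] := val_integrable ch bh (pcont_measurable (@detroot_op_pcont R N))
  (Pinfty_detroot N0 Pmu).
by under eq_fun do rewrite posop1_detroot.
Qed.

Lemma arithmetic_detroot M mu : is_arithmetic M -> Pinfty mu ->
  posop1_val (M 1%N (pushforward mu (@detroot_op R N))) <= detroot (M N mu).
Proof.
move=> aM Pmu; have [P [e [mP e0 e1 H]]] := Pinfty_integrable Pmu.
have Id := detroot_integrable mP Pmu (@id_cont R) (@id_bounded R).
have XE := aM _ _ Pmu; set X := M N mu in XE *.
rewrite mP in Pmu XE *.
rewrite (arithmetic1E (pcont_measurable (@detroot_op_pcont R N)) (Pinfty_detroot N0 Pmu) aM).
under eq_Rintegral do rewrite posop1_detroot.
have [IR II] := entries_integrable H (@mxcont_id R N)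
  (fun A qA i j => posop_entry_le i j e0 qA).
exact: (detroot_jensen (F := id)).
Qed.

Definition posop_inv (A : posop R N) : posop R N := Posop (posmx_inv (posmxP A)).

Lemma harmonic_detroot M mu : is_harmonic M -> Pinfty mu ->
  detroot (M N mu) <= posop1_val (M 1%N (pushforward mu (@detroot_op R N))).
Proof.
move=> hM Pmu; have [P [e [mP e0 e1 H]]] := Pinfty_integrable Pmu.
have Id := detroot_integrable mP Pmu (@inv_cont R) (@inv_bounded R).
have := hM _ _ Pmu; set X := M N mu; rewrite mP in Pmu *.
move=> /(congr1 invmx); rewrite invmxK => YE.
rewrite -lef_pV2 ?posrE ?detroot_gt0 ?posop1_gt0//.
rewrite (harmonic1E (pcont_measurable (@detroot_op_pcont R N)) (Pinfty_detroot N0 Pmu) hM).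
under eq_Rintegral do rewrite posop1_detroot.
have iE (A : posop R N) : detroot (posop_inv A) = (detroot A)^-1 by exact: detroot_inv.
have [IR II] := entries_integrable H (@mxcont_inv R N)
  (fun A qA i j => posop_inv_entry_le i j e0 qA).
rewrite -iE; under eq_Rintegral do rewrite -iE.
apply: (detroot_jensen (F := posop_inv)) => //.
by move: Id; under eq_fun do rewrite -iE.
Qed.

Lemma ln_geometric_mean n (x : 'I_n -> R) : (0 < n)%N -> (forall i, 0 < x i) ->
  \sum_i ln (x i) = n%:R * ln ((\prod_i x i) `^ n%:R^-1).
Proof.
move=> n0 x0; rewrite (powR_prod_expR x0) expRK mulrC divfK//.
by rewrite pnatr_eq0 -lt0n.
Qed.

(** The trace of log is the logarithm of the determinant, so tracing loses nothing here and equality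
    results; the Karcher mean can thus start both inductions. *)
Lemma karcher_detroot M mu : is_karcher M -> Pinfty mu ->
  posop1_val (M 1%N (pushforward mu (@detroot_op R N))) = detroot (M N mu).
Proof.
move=> kM Pmu; have [P [e [mP e0 e1 H]]] := Pinfty_integrable Pmu.
have Id := detroot_integrable mP Pmu (@ln_cont R) (@ln_bounded_inv R).
have [+ _] := kM _ _ Pmu; set X := M N mu => XE; rewrite mP in Pmu XE *.
apply: ln_inj; rewrite ?posrE ?detroot_gt0 ?posop1_gt0//.
rewrite (karcher1E (pcont_measurable (@detroot_op_pcont R N)) (Pinfty_detroot N0 Pmu) kM).
under eq_Rintegral do rewrite posop1_detroot.
have [K hK] := mxlog_cong_entry_le X e0.
have [IR II] := entries_integrable H (mxlog_cong_mxcont X) hK.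
(* Pairing the Karcher equation with the identity matrix takes its trace. *)
have [_] := Rintegral_tr 1%:M IR II; rewrite XE mulmx0 mxtrace0 [RHS]/=.
have tE (A : posop R N) :
    complex.Re (\tr (1%:M *m mxlog (invmx (mxsqrt X) *m A *m invmx (mxsqrt X)))) =
    N%:R * (ln (detroot A) - ln (detroot X)).
  rewrite mul1mx tr_mxfun [LHS]/= (ln_geometric_mean N0); last first.
    by move=> i; exact: eigr_gt0 (posmx_cong X A).
  by rewrite prod_eigr_cong ln_div ?posrE ?detroot_gt0.
under eq_Rintegral do rewrite tE.
have Icst : P.-integrable setT (EFin \o cst (ln (detroot X))).
  exact: finite_measure_integrable_cst.
have Ib : P.-integrable setT (EFin \o (fun A => ln (detroot A) - ln (detroot X))).
  exact: (integrableB measurableT Id Icst).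
rewrite (RintegralZl _ measurableT Ib) => /eqP; rewrite mulf_eq0 pnatr_eq0.
rewrite -(negbK (N == 0)%N) -lt0n N0 /= (RintegralB measurableT Id Icst).
rewrite Rintegral_cst//.
have -> : fine (P setT) = 1 by rewrite probability_setT.
by rewrite mulr1 subr_eq0 => /eqP.
Qed.

(** The chain is M(d(X) sigma d_* mu) <= M(d_*(X sigma mu)) <= d(M(X sigma mu)) = d(X), to which the
    scalar comparison applies. The middle inequality is the induction hypothesis at X sigma mu,
    which is why it ranges over all of [Pinfty]. *)
Lemma deformation_detroot_ge M sigma M' mu : homog1 M -> mono1 M -> gcv sigma ->
  is_deformation M sigma M' ->
  (forall nu, Pinfty nu ->
    posop1_val (M 1%N (pushforward nu (@detroot_op R N))) <= detroot (M N nu)) ->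
  Pinfty mu ->
  posop1_val (M' 1%N (pushforward mu (@detroot_op R N))) <= detroot (M' N mu).
Proof.
move=> hM mM gs dM IH Pmu; have gs' : gcv sigma \/ gcc sigma by left.
have [+ _] := dM _ _ Pmu; set X := M' N mu => XE.
rewrite -posop1_detroot.
apply: (deformation_le hM mM gs' dM (Pinfty_detroot N0 Pmu)).
have PX := Pinfty_opmean X gs' Pmu.
rewrite [leRHS]posop1_detroot [in leRHS]XE; apply: le_trans (IH _ PX).
have P1 := Pinfty_opmean (detroot_op X) gs' (Pinfty_detroot N0 Pmu).
have P2 := Pinfty_detroot N0 PX.
have [P mP] := Pinfty_prob Pmu; rewrite {XE}mP in P1 P2 *.
(* Both measures are images of the same P, under A -> d(X) sigma d(A) and A -> d(X sigma A), so the
   pointwise inequality suffices. *)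
apply: (mM _ _ P (opmean_app sigma (detroot_op X) \o @detroot_op R N)
  (@detroot_op R N \o opmean_app sigma X)) => //.
- apply: measurableT_comp; first exact: pcont_measurable (opmean_app_pcont _ gs').
  exact: pcont_measurable (@detroot_op_pcont R N).
- apply: measurableT_comp; first exact: pcont_measurable (@detroot_op_pcont R N).
  exact: pcont_measurable (opmean_app_pcont _ gs').
by move=> A; rewrite [leRHS]posop1_detroot; exact: gcv_detroot_opmean.
Qed.

Lemma deformation_detroot_le M sigma M' mu : homog1 M -> mono1 M -> gcc sigma ->
  is_deformation M sigma M' ->
  (forall nu, Pinfty nu ->
    detroot (M N nu) <= posop1_val (M 1%N (pushforward nu (@detroot_op R N)))) ->
  Pinfty mu ->
  detroot (M' N mu) <= posop1_val (M' 1%N (pushforward mu (@detroot_op R N))).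
Proof.
move=> hM mM gs dM IH Pmu; have gs' : gcv sigma \/ gcc sigma by right.
have [+ _] := dM _ _ Pmu; set X := M' N mu => XE.
rewrite -posop1_detroot.
apply: (deformation_ge hM mM gs' dM (Pinfty_detroot N0 Pmu)).
have PX := Pinfty_opmean X gs' Pmu.
rewrite [leLHS]posop1_detroot [in leLHS]XE; apply: le_trans (IH _ PX) _.
have P1 := Pinfty_opmean (detroot_op X) gs' (Pinfty_detroot N0 Pmu).
have P2 := Pinfty_detroot N0 PX.
have [P mP] := Pinfty_prob Pmu; rewrite {XE}mP in P1 P2 *.
apply: (mM _ _ P (@detroot_op R N \o opmean_app sigma X)
  (opmean_app sigma (detroot_op X) \o @detroot_op R N)) => //.
- apply: measurableT_comp; first exact: pcont_measurable (@detroot_op_pcont R N).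
  exact: pcont_measurable (opmean_app_pcont _ gs').
- apply: measurableT_comp; first exact: pcont_measurable (opmean_app_pcont _ gs').
  exact: pcont_measurable (@detroot_op_pcont R N).
by move=> A; rewrite [leLHS]posop1_detroot; exact: gcc_detroot_opmean.
Qed.

(** Pushing a finite combination of point masses along d moves its atoms and keeps its weights. The
    hypotheses on the [Ms j] then compare atoms, monotonicity of [M0] in dimension one absorbs this,
    and the hypothesis on [M0] concludes. *)
Lemma composition_detroot_ge n (w : 'I_n -> R) M0 (Ms : 'I_n -> mean R) M' mu :
  (forall j, 0 <= w j) -> \sum_j w j = 1 -> mono1 M0 -> is_composition w M0 Ms M' ->
  (forall nu, Pinfty nu ->
    posop1_val (M0 1%N (pushforward nu (@detroot_op R N))) <= detroot (M0 N nu)) ->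
  (forall j nu, Pinfty nu ->
    posop1_val (Ms j 1%N (pushforward nu (@detroot_op R N))) <= detroot (Ms j N nu)) ->
  Pinfty mu ->
  posop1_val (M' 1%N (pushforward mu (@detroot_op R N))) <= detroot (M' N mu).
Proof.
move=> w0 w1 m0 cM IH0 IHs Pmu.
rewrite (cM _ _ Pmu) (cM _ _ (Pinfty_detroot N0 Pmu)).
apply: le_trans (IH0 _ (Pinfty_dirac_sum (fun j => Ms j N mu) w0 w1)).
rewrite dirac_sum_preimage; apply: dirac_sum_mono1 => // j.
by rewrite [leRHS]posop1_detroot; exact: IHs.
Qed.

Lemma composition_detroot_le n (w : 'I_n -> R) M0 (Ms : 'I_n -> mean R) M' mu :
  (forall j, 0 <= w j) -> \sum_j w j = 1 -> mono1 M0 -> is_composition w M0 Ms M' ->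
  (forall nu, Pinfty nu ->
    detroot (M0 N nu) <= posop1_val (M0 1%N (pushforward nu (@detroot_op R N)))) ->
  (forall j nu, Pinfty nu ->
    detroot (Ms j N nu) <= posop1_val (Ms j 1%N (pushforward nu (@detroot_op R N)))) ->
  Pinfty mu ->
  detroot (M' N mu) <= posop1_val (M' 1%N (pushforward mu (@detroot_op R N))).
Proof.
move=> w0 w1 m0 cM IH0 IHs Pmu.
rewrite (cM _ _ Pmu) (cM _ _ (Pinfty_detroot N0 Pmu)).
apply: le_trans (IH0 _ (Pinfty_dirac_sum (fun j => Ms j N mu) w0 w1)) _.
rewrite dirac_sum_preimage; apply: dirac_sum_mono1 => // j.
by rewrite [leLHS]posop1_detroot; exact: IHs.
Qed.

End Main.

Theorem proposition7p9 (R : realType) (N : nat) (N_gt0 : (0 < N)%N)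
    (M : mean R) :
  (derived_plus M -> forall mu : set (posop R N) -> \bar R, Pinfty mu ->
     posop1_val (M 1%N (pushforward mu (@detroot_op R N)))
       <= detroot (M N mu)) /\
  (derived_minus M -> forall mu : set (posop R N) -> \bar R, Pinfty mu ->
     detroot (M N mu)
       <= posop1_val (M 1%N (pushforward mu (@detroot_op R N)))).
Proof.
split.
  (* Homogeneity and monotonicity are read off from the derivation at each node, so the main
     induction carries the inequality alone. *)
  have hp (M0 : mean R) : derived_plus M0 -> homog1 M0 /\ mono1 M0.
    apply: derived_homog1_mono1 => [M1|sigma gs]; last by left.
    by case; [constructor 1|constructor 3].
  elim=> {M} [M [aM|kM]|M sigma M' dM IH gs _ defM|n w M0 Ms M' w0 w1 d0 IH0 ds IHs cM] mu Pmu.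
  - exact: arithmetic_detroot.
  - by rewrite karcher_detroot.
  - have [hM mM] := hp _ dM; exact: deformation_detroot_ge defM IH Pmu.
  - have [_ m0] := hp _ d0; exact: composition_detroot_ge cM IH0 IHs Pmu.
have hm (M0 : mean R) : derived_minus M0 -> homog1 M0 /\ mono1 M0.
  apply: derived_homog1_mono1 => [M1|sigma gs]; last by right.
  by case; [constructor 2|constructor 3].
elim=> {M} [M [hM|kM]|M sigma M' dM IH gs _ defM|n w M0 Ms M' w0 w1 d0 IH0 ds IHs cM] mu Pmu.
- exact: harmonic_detroot.
- by rewrite karcher_detroot.
- have [hM mM] := hm _ dM; exact: deformation_detroot_le defM IH Pmu.
- have [_ m0] := hm _ d0; exact: composition_detroot_le cM IH0 IHs Pmu.
Qed.
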